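(* 1. Let $q$ be an integer with $5\le q<\infty$. If $n$ is large enough, $n\ge N(q)$, and $\varepsilon$ is small enough, $0<\varepsilon\le\varepsilon(n,q)$ (with some $\varepsilon(n,q)>0$), then the Minkowski polynomial $M_{E_{n,q,\varepsilon}}^{\mathbb{R}^{n+q}}$ is not dissipative: some of its roots are situated in the open right half-plane $\{z:\mathrm{Re}\,z>0\}$. 2. Let $p$ be an integer and $q$ an odd integer with $p\ge 1$, $q\ge 1$, $p+q\ge 6$. If $n$ is large enough, $n\ge N(p,q)$, and $\varepsilon$ is small enough, $0<\varepsilon\le\varepsilon(n,p,q)$ (with some $\varepsilon(n,p,q)>0$), then the Weyl polynomial $W^p_{\partial E_{n,q,\varepsilon}}$ is not conservative: some of its roots do not belong to the imaginary axis.
   Context: For integers $n,q\ge1$ and $\varepsilon>0$, $E_{n,q,\varepsilon}$ is the ellipsoid $$E_{n,q,\varepsilon}=\Big\{(x_1,\dots,x_{n+q})\in\mathbb{R}^{n+q}:\ \sum_{1\le j\le n+q}(x_j/a_j)^2\le 1\Big\},$$ where $a_j=1$ for $1\le j\le n$ and $a_j=\varepsilon$ for $n+1\le j\le n+q$. For a compact convex $U\subset\mathbb{R}^{N}$, with $B^N$ the closed Euclidean unit ball of $\mathbb{R}^N$, the Minkowski polynomial is $M_U^{\mathbb{R}^{N}}(t)=\mathrm{Vol}_{N}(U+tB^{N})=\sum_{k=0}^{N} m_k^{\mathbb{R}^{N}}(U)t^k$ ($t\ge0$; this is a polynomial in $t$). The Weyl coefficients of $\partial U$ are $$k_{2l}(\partial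 U)=2^l\frac{\Gamma(l+\frac12+1)}{\Gamma(\frac12+1)}\,m_{2l+1}^{\mathbb{R}^{N}}(U),\qquad 0\le l\le \Big[\frac{N-1}{2}\Big],$$ and the Weyl polynomial of index $p$ is $$W^p_{\partial U}(t)=\sum_{l=0}^{[(N-1)/2]}\frac{2^{-l}\Gamma(\frac p2+1)}{\Gamma(\frac p2+l+1)}k_{2l}(\partial U)t^{2l}.$$ All polynomials are considered for complex $t$. A polynomial is dissipative if all its roots lie in $\{z:\mathrm{Re}\,z<0\}$; it is conservative if all its roots are purely imaginary and simple. *)

(* Defs.v *)
From HB Require Import structures.
From mathcomp Require Import all_boot all_order all_algebra.
From mathcomp Require Import complex.
From mathcomp Require Import all_classical all_reals all_analysis.

Set Implicit Arguments.
Unset Strict Implicit.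
Unset Printing Implicit Defensive.

Import Order.TTheory GRing.Theory Num.Theory.

Local Open Scope classical_set_scope.
Local Open Scope ring_scope.

Definition tuple_cons (T : Type) n (u : T * n.-tuple T) : n.+1.-tuple T :=
  [tuple of u.1 :: u.2].

Definition tuple_uncons (T : Type) n (t : n.+1.-tuple T) : T * n.-tuple T :=
  (thead t, [tuple of behead t]).

Lemma tuple_unconsK (T : Type) n :
  cancel (@tuple_uncons T n) (@tuple_cons T n).
Proof. by move=> t; rewrite [RHS]tuple_eta. Qed.

Lemma tuple_consK (T : Type) n :
  cancel (@tuple_cons T n) (@tuple_uncons T n).
Proof.
by case=> x t; rewrite /tuple_uncons theadE; congr pair; exact/val_inj.
Qed.

Lemma measurable_tuple_cons d (T : measurableType d) n :
  measurable_fun setT (@tuple_cons T n).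
Proof. exact: measurable_cons. Qed.

Lemma measurable_tuple_uncons d (T : measurableType d) n :
  measurable_fun setT (@tuple_uncons T n).
Proof.
apply/measurable_fun_pairP; split; last exact: measurable_behead.
exact: measurable_tnth.
Qed.

Lemma sigma_finite_product_measure1 d1 d2 (T1 : measurableType d1)
    (T2 : measurableType d2) (R : realType)
    (m1 : {sigma_finite_measure set T1 -> \bar R})
    (m2 : {sigma_finite_measure set T2 -> \bar R}) :
  sigma_finite setT (m1 \x m2)%E.
Proof.
have /sigma_finiteP[F [TF ndF Foo]] := sigma_finiteT m1.
have /sigma_finiteP[G [TG ndG Goo]] := sigma_finiteT m2.
exists (fun n => F n `*` G n).
  rewrite -setXTT TF TG predeqE => -[x y]; split.
    move=> [/= [n _ Fnx] [k _ Gky]]; exists (maxn n k) => //; split.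
    - by move: x Fnx; exact/subsetPset/ndF/leq_maxl.
    - by move: y Gky; exact/subsetPset/ndG/leq_maxr.
  by move=> [n _ []/= ? ?]; split; exists n.
move=> k; have [? ?] := Foo k; have [? ?] := Goo k.
split; first exact: measurableX.
by rewrite product_measure1E// lte_mul_pinfty// ge0_fin_numE.
Qed.

Section tuple_measure_succ.
Context d (T : measurableType d) (R : realType) (n : nat).
Variable mu : {sigma_finite_measure set T -> \bar R}.
Variable m : {sigma_finite_measure set (n.-tuple T) -> \bar R}.

Definition tuple_measure_succ : set (n.+1.-tuple T) -> \bar R :=
  pushforward (mu \x m)%E (@tuple_cons T n).

HB.instance Definition _ := Measure.copy tuple_measure_succ
  (measure_function_pushforward__canonical__measure_function_Measure
     (mu \x m)%E (@measurable_tuple_cons _ T n)).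

Let tuple_measure_succ_sigma_finite : sigma_finite setT tuple_measure_succ.
Proof.
have [F FT Ffin] := sigma_finite_product_measure1 mu m.
exists (fun i => @tuple_uncons T n @^-1` F i).
  by rewrite -preimage_bigcup -FT preimage_setT.
move=> i; have [mF Foo] := Ffin i; split.
  by rewrite -[X in measurable X]setTI; exact: measurable_tuple_uncons.
rewrite /tuple_measure_succ /pushforward -comp_preimage.
suff -> : @tuple_uncons T n \o @tuple_cons T n = id by [].
by apply/funext => u; exact: tuple_consK.
Qed.

HB.instance Definition _ := @Measure_isSigmaFinite.Build _ _ _
  tuple_measure_succ tuple_measure_succ_sigma_finite.

End tuple_measure_succ.

(* The n-fold power of mu, on the product sigma-algebra of n.-tuple T. *)
Fixpoint tuple_measure d (T : measurableType d) (R : realType)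
    (mu : {sigma_finite_measure set T -> \bar R}) (n : nat) :
    {sigma_finite_measure set (n.-tuple T) -> \bar R} :=
  match n with
  | 0 => \d_([tuple] : 0.-tuple T)
  | n'.+1 => tuple_measure_succ mu (tuple_measure mu n')
  end.

Section euclidean.
Context {R : realType}.

Definition volume (N : nat) (A : set 'rV[R]_N) : \bar R :=
  tuple_measure (@lebesgue_measure R) N
    [set t : N.-tuple R | A (\row_i tnth t i)].

(* The norm of 'rV[R]_N in the library is the sup norm, so the Euclidean unit
   ball is spelled out. *)
Definition euclidean_ball (N : nat) : set 'rV[R]_N :=
  [set x : 'rV[R]_N | \sum_i x ord0 i ^+ 2 <= 1].

Arguments euclidean_ball : clear implicits.

Definition parallel_body (N : nat) (U : set 'rV[R]_N) (t : R) :
    set 'rV[R]_N :=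
  [set x + t *: b | x in U & b in euclidean_ball N].

Definition semiaxis (n q : nat) (eps : R) (j : 'I_(n + q)) : R :=
  if (j < n)%N then 1 else eps.

Arguments semiaxis : clear implicits.

Definition ellipsoid (n q : nat) (eps : R) : set 'rV[R]_(n + q) :=
  [set x : 'rV[R]_(n + q) | \sum_j (x ord0 j / semiaxis n q eps j) ^+ 2 <= 1].

Arguments ellipsoid : clear implicits.

(* M is determined by U, since a polynomial is determined by its values on
   [0, +oo[; such an M exists for every nonempty compact convex U by the
   Steiner-Minkowski theorem. *)
Definition is_minkowski_poly (N : nat) (U : set 'rV[R]_N) (M : {poly R}) :=
  (size M <= N.+1)%N /\
  forall t : R, 0 <= t -> volume (parallel_body U t) = (M.[t])%:E.

Definition Gamma (x : R) : R :=
  \int[lebesgue_measure]_(t in `]0, +oo[) (t `^ (x - 1) * expR (- t)).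

(* weyl_coef M l is the coefficient k_(2l) of the boundary of a body with
   Minkowski polynomial M. *)
Definition weyl_coef (M : {poly R}) (l : nat) : R :=
  2 ^+ l * (Gamma (l%:R + 2^-1 + 1) / Gamma (2^-1 + 1)) * M`_(2 * l).+1.

Definition weyl_poly (N p : nat) (M : {poly R}) : {poly R} :=
  \sum_(l < (N.-1)./2.+1)
    (2 ^- l * Gamma (p%:R / 2 + 1) / Gamma (p%:R / 2 + l%:R + 1)
      * weyl_coef M l) *: 'X^(2 * l).

Definition complex_poly (P : {poly R}) : {poly R[i]} :=
  map_poly (real_complex R) P.

Definition dissipative (P : {poly R[i]}) : Prop :=
  forall z : R[i], root P z -> complex.Re z < 0.

Definition conservative (P : {poly R[i]}) : Prop :=
  forall z : R[i], root P z -> complex.Re z = 0 /\ mup z P = 1%N.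

End euclidean.

Arguments euclidean_ball {R} N.
Arguments semiaxis {R} n q eps j.
Arguments ellipsoid {R} n q eps.

(* Main.v *)
Require Import Defs.
From mathcomp Require Import all_boot all_order all_algebra.
From mathcomp Require Import complex.
From mathcomp Require Import all_classical all_reals all_analysis.
From mathcomp Require Import measurable_realfun.
From mathcomp Require Import ring lra zify.
From Stdlib Require BinInt.
From mathcomp Require Import ssrZ.

(** As eps tends to 0 the ellipsoid shrinks to the flat disc D = B^n x {0} in
R^(n+q), and its Minkowski polynomial tends coefficientwise to the volume
polynomial of the neighbourhoods of D, namely (with kappa_m the volume of B^m)

  V(t) = sum_k C(n,k) kappa_n (kappa_(q+k) / kappa_k) t^(q+k).

The limit is obtained by squeezing: for t > 0 the parallel body of the
ellipsoid at distance t contains the t-neighbourhood of D and lies in its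
(t+eps)-neighbourhood ([minkowski_poly_bounds]).  The volumes are computed by
Fubini, and kappa_m Gamma(m/2+1) = sqrt(pi)^m comes from the Gaussian integral
([ball_volume_gamma]); only ratios of the kappa_m and of values of Gamma enter
the argument.

Keep in V(t) the exponents of the parity of q.  Up to a constant and a power of
t this leaves A_(n,q)(t^2), where

  A_(n,Q)(u) = sum_j C(n,2j) beta_(Q,j) u^j,
  beta_(Q,j) = prod_(1 <= i <= j) 2i / (2i+Q)

([disc_even]).  In the same way the Weyl polynomial of index p, q being odd,
tends to a constant times t^(q-1) A_(n,p+q-1)(t^2).  Suppose that for
arbitrarily small eps the Minkowski polynomial has no root in the open right
half-plane.  By a Hermite-Biehler argument ([stable_even_part],
[stable_odd_part]) its even and odd parts, as polynomials in u = t^2, have only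
real nonpositive roots.  If the Weyl polynomial has only imaginary roots, the
same is clear for it.  Real-rootedness survives the limit
([vertical_mono_lim]), so in both cases A_(n,Q) has only real nonpositive
roots, for some Q >= 5.

This is impossible for large n.  First, (Q+2) A_(n,Q) equals
(Q+2) A_(n,Q+2) + 2 u A_(n,Q+2)', and p -> a p + 2 u p' preserves
nonpositive real roots when a > 0 (Gauss-Lucas for t^a p(t^2)); so Q may be
lowered by steps of 2 until it is 5 or 6 ([disc_even_base]).  For these two
values A_(n,Q)(u / n^2) tends, as n grows, to an entire function which has
nonreal zeros: on the negative axis it approaches 0 without changing sign any
more, while still oscillating.  At u = -260 for Q = 5 and u = -100 for Q = 6 it
is close to a negative local maximum, where the Laguerre inequality
p'^2 - p p'' >= 0 of real-rooted polynomials fails.  This is checked with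
rational arithmetic on a partial sum and a geometric bound for the tail, and
the strict inequality persists for all large n. *)

Set Implicit Arguments.
Unset Strict Implicit.
Unset Printing Implicit Defensive.

Import Order.TTheory GRing.Theory Num.Theory.
Import numFieldNormedType.Exports.

Local Open Scope classical_set_scope.
Local Open Scope ring_scope.

(** * Integration on tuples *)

Section tuple_integral.
Context d (E : measurableType d) {R : realType}.
Variable mu : {sigma_finite_measure set E -> \bar R}.

Local Notation T_ n := (tuple_measure mu n).
Local Open Scope ereal_scope.

(** The integral of a nonnegative function is a supremum over the simple
functions below it, so monotonicity extends to functions that are not
measurable. *)
Lemma le_integral_nonneg (dT : measure_display) (T : measurableType d)
    (m : {measure set T -> \bar R}) (D : set T) (f g : T -> \bar R) :
  (forall x, 0 <= f x) -> (forall x, f x <= g x) ->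
  \int[m]_(x in D) f x <= \int[m]_(x in D) g x.
Proof.
move=> f0 fg.
have g0 x : 0 <= g x by exact: le_trans (fg x).
rewrite !ge0_integralE//; apply: ge_ereal_sup => _ [h hf <-].
apply: ereal_sup_ubound; exists h => // x; apply: le_trans (hf x) _.
by rewrite /patch; case: ifP.
Qed.

(** Stated for arbitrary sets, so that a parallel body can be compared directly
with explicit neighbourhoods. *)
Lemma tuple_measure_mono n (A B : set (n.-tuple E)) :
  A `<=` B -> T_ n A <= T_ n B.
Proof.
elim: n A B => [|n IH] A B AB /=.
  rewrite /dirac/= lee_fin !indicE ler_nat.
  case: (boolP ([tuple] \in A)) => //; rewrite inE => /AB.
  by rewrite -inE => ->.
rewrite /tuple_measure_succ /pushforward /= /product_measure1.
apply: (@le_integral_nonneg d E mu setT) => x //=.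
by apply: IH => t; rewrite /xsection/= !inE/=; exact: AB.
Qed.

Lemma integral_tuple0 (F : 0.-tuple E -> \bar R) :
  \int[T_ 0]_t F t = F [tuple].
Proof.
rewrite /= integral_dirac ?diracT ?mul1e //.
move=> _ A mA; rewrite setTI.
have [HF|HF] := pselect (A (F [tuple])).
  suff -> : F @^-1` A = setT by [].
  by apply/seteqP; split => // t _ /=; rewrite (tuple0 t).
suff -> : F @^-1` A = set0 by [].
by apply/seteqP; split => // t /=; rewrite (tuple0 t).
Qed.

Lemma integral_tupleS n (F : n.+1.-tuple E -> \bar R) :
  measurable_fun setT F -> (forall t, 0 <= F t) ->
  \int[T_ n.+1]_t F t = \int[mu]_x \int[T_ n]_t F (tuple_cons (x, t)).
Proof.
move=> mF F0 /=; rewrite /tuple_measure_succ.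
rewrite ge0_integral_pushforward//=; last by exact: measurable_tuple_cons.
rewrite preimage_setT fubini_tonelli1//=.
apply: measurableT_comp => //; exact: measurable_tuple_cons.
Qed.

End tuple_integral.

(** * Radial integrals *)

Section radial.
Context {R : realType}.
Local Notation leb := (@lebesgue_measure R).
Local Notation mR := (measurableTypeR R).
Local Notation T_ n := (tuple_measure leb n).
Local Open Scope ereal_scope.

Definition sqnorm n (t : n.-tuple mR) : R := (\sum_(i < n) tnth t i ^+ 2)%R.

Definition sqhead n q (t : (n + q).-tuple mR) : R :=
  (\sum_(i < n) tnth t (lshift q i) ^+ 2)%R.

Definition sqtail n q (t : (n + q).-tuple mR) : R :=
  (\sum_(i < q) tnth t (rshift n i) ^+ 2)%R.

Lemma measurable_sqsum n (I : Type) (s : seq I) (f : I -> 'I_n) :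
  measurable_fun [set: n.-tuple mR]
    (fun t : n.-tuple mR => (\sum_(i <- s) tnth t (f i) ^+ 2)%R : R).
Proof.
apply: measurable_sum => i.
by apply: measurable_funX; exact: measurable_tnth.
Qed.

Lemma measurable_sqnorm n : measurable_fun [set: n.-tuple mR] (@sqnorm n).
Proof. exact: measurable_sqsum. Qed.

Lemma measurable_sqhead n q :
  measurable_fun [set: (n + q).-tuple mR] (@sqhead n q).
Proof. exact: measurable_sqsum. Qed.

Lemma measurable_sqtail n q :
  measurable_fun [set: (n + q).-tuple mR] (@sqtail n q).
Proof. exact: measurable_sqsum. Qed.

Lemma tnth_consS n (x : mR) (t : n.-tuple mR) i (j : 'I_n.+1) :
  val j = (val i).+1 -> tnth (tuple_cons (x, t)) j = tnth t i.
Proof. by move=> ji; rewrite !(tnth_nth (0%R : R)) ji. Qed.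

Lemma sqnorm_cons n x (t : n.-tuple mR) :
  sqnorm (tuple_cons (x, t)) = (x ^+ 2 + sqnorm t)%R.
Proof.
rewrite /sqnorm big_ord_recl; congr (_ + _)%R.
by apply: eq_bigr => i _; rewrite (tnth_consS _ _ (i := i)).
Qed.

Lemma sqhead_cons n q x (t : (n + q).-tuple mR) :
  @sqhead n.+1 q (tuple_cons (x, t)) = (x ^+ 2 + sqhead t)%R.
Proof.
rewrite /sqhead big_ord_recl; congr (_ + _)%R.
by apply: eq_bigr => i _; rewrite (tnth_consS _ _ (i := lshift q i)).
Qed.

Lemma sqtail_cons n q x (t : (n + q).-tuple mR) :
  @sqtail n.+1 q (tuple_cons (x, t)) = sqtail t.
Proof. by apply: eq_bigr => i _; rewrite (tnth_consS _ _ (i := rshift n i)). Qed.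

Lemma sqnorm_ge0 n (t : n.-tuple mR) : (0 <= sqnorm t)%R.
Proof. by apply: sumr_ge0 => i _; rewrite sqr_ge0. Qed.

Lemma measurable_radial n (F : R -> \bar R) :
  measurable_fun [set: R] F ->
  measurable_fun [set: n.-tuple mR] (fun t : n.-tuple mR => F (sqnorm t)).
Proof. by move=> mF; exact: (measurableT_comp mF (@measurable_sqnorm n)). Qed.

Lemma integral_radialS n (F : R -> \bar R) :
  measurable_fun [set: R] F -> (forall s, 0 <= F s) ->
  \int[T_ n.+1]_t F (sqnorm t) =
  \int[leb]_x \int[T_ n]_t F (x ^+ 2 + sqnorm t)%R.
Proof.
move=> mF F0.
rewrite (integral_tupleS leb (F := fun t : n.+1.-tuple mR => F (sqnorm t)))//.
  by apply: eq_integral => x _; apply: eq_integral => t _; rewrite sqnorm_cons.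
exact: measurable_radial.
Qed.

Lemma measurable_pair_radial n q (F : R * R -> \bar R) :
  measurable_fun [set: R * R] F ->
  measurable_fun [set: n.-tuple mR * q.-tuple mR]
    (fun z : (n.-tuple mR * q.-tuple mR)%type => F (sqnorm z.1, sqnorm z.2)).
Proof.
move=> mF.
apply: (measurableT_comp (f := F)
  (g := fun z : (n.-tuple mR * q.-tuple mR)%type => (sqnorm z.1, sqnorm z.2))) => //.
apply/measurable_fun_pairP; split.
  exact: measurableT_comp (@measurable_sqnorm n) measurable_fst.
exact: measurableT_comp (@measurable_sqnorm q) measurable_snd.
Qed.

(** Fubini for functions of the two partial square norms, peeling off the first
n coordinates one at a time. *)
Lemma integral_head_tail n q (F : R * R -> \bar R) :
  measurable_fun [set: R * R] F -> (forall s, 0 <= F s) ->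
  \int[T_ (n + q)]_t F (sqhead t, sqtail t) =
  \int[T_ n]_x \int[T_ q]_y F (sqnorm x, sqnorm y).
Proof.
move=> mF F0; elim: n F mF F0 => [|n IH] F mF F0.
  rewrite integral_tuple0; apply: eq_integral => t _.
  rewrite /sqhead /sqnorm !big_ord0; congr (F (_, _)).
  by apply: eq_bigr => i _; congr (tnth t _ ^+ 2)%R; exact: val_inj.
rewrite (integral_tupleS leb
  (F := fun t : (n.+1 + q).-tuple mR => F (@sqhead n.+1 q t, @sqtail n.+1 q t)))//.
  rewrite (integral_tupleS leb
  (F := fun x : n.+1.-tuple mR => \int[T_ q]_y F (sqnorm x, sqnorm y)))//.
  - apply: eq_integral => x _.
    under eq_integral do rewrite sqhead_cons sqtail_cons.
    rewrite (IH (fun s => F (x ^+ 2 + s.1, s.2)%R))//.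
      apply: eq_integral => t _; apply: eq_integral => y _.
      by rewrite sqnorm_cons.
    apply: (measurableT_comp (f := F)
      (g := fun s : R * R => (x ^+ 2 + s.1, s.2)%R)) => //.
    apply/measurable_fun_pairP; split; last exact: measurable_snd.
    by apply: measurable_funD => //; exact: measurable_fst.
  - exact: (measurable_fun_fubini_tonelli_F _ (@measurable_pair_radial n.+1 q F mF) (fun=> F0 _)).
  - by move=> t; exact: integral_ge0.
apply: (measurableT_comp (f := F)
  (g := fun t : (n.+1 + q).-tuple mR => (@sqhead n.+1 q t, @sqtail n.+1 q t))) => //.
by apply/measurable_fun_pairP; split;
  [exact: (@measurable_sqhead n.+1 q)|exact: (@measurable_sqtail n.+1 q)].
Qed.

End radial.

(** * Volumes of balls *)

Section balls.
Context {R : realType}.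
Local Notation leb := (@lebesgue_measure R).
Local Notation mR := (measurableTypeR R).
Local Notation T_ n := (tuple_measure leb n).
Local Open Scope ereal_scope.

(** Lebesgue measure is r times its image under multiplication by r: both agree
on half-open intervals, hence everywhere. *)
Lemma integral_scale (r : R) (f : R -> \bar R) :
  (0 < r)%R -> measurable_fun [set: R] f -> (forall x, 0 <= f x) ->
  \int[leb]_x f x = r%:E * \int[leb]_x f (r * x)%R.
Proof.
move=> r0 mf f0.
have mr : measurable_fun [set: mR] ( *%R r : mR -> mR) by exact: mulrl_measurable.
pose nu := mscale (NngNum (ltW r0))
  (measure_function_pushforward__canonical__measure_function_Measure leb mr).
have -> : \int[leb]_x f x = \int[nu]_x f x.
  rewrite (@eq_measure_integral _ mR R setT nu leb)// => A mA _.
  apply: lebesgue_measure_unique mA => _ [[a b] _ <-] /=.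
  rewrite /mscale/= /pushforward.
  have -> : (( *%R r : R -> R) @^-1` `]a, b]%classic)%R =
            `](a / r)%R, (b / r)%R]%classic.
    apply/seteqP; split => x /=; rewrite !in_itv/= ltr_pdivrMr// ler_pdivlMr//;
    by rewrite mulrC.
  rewrite !lebesgue_measure_itv/= !lte_fin ltr_pM2r ?invr_gt0//.
  case: ifPn => ab; last by rewrite mule0.
  by rewrite -!EFinD -EFinM mulrBr !(mulrC r) !divfK ?gt_eqF.
rewrite ge0_integral_mscale//=; congr (_ * _).
by rewrite ge0_integral_pushforward//= ?preimage_setT.
Qed.

(** The indicator of x <= y, with values in the extended reals so that it can be
integrated and multiplied without casts. *)
Definition le_ind (x y : R) : \bar R := ((x <= y)%R%:R : R)%:E.

Lemma le_ind_ge0 x y : 0 <= le_ind x y.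
Proof. by rewrite lee_fin. Qed.

Lemma measurable_le_ind d (T : measurableType d) (f g : T -> R) :
  measurable_fun [set: T] f -> measurable_fun [set: T] g ->
  measurable_fun [set: T] (fun x => le_ind (f x) (g x)).
Proof.
move=> mf mg; apply/measurable_EFinP.
apply: (measurableT_comp (f := fun b : bool => (b%:R : R))
                         (g := fun x => (f x <= g x)%R)) => //.
exact: measurable_fun_ler.
Qed.

Definition ball_volume m (s : R) : \bar R := \int[T_ m]_t le_ind (sqnorm t) s.
Local Notation Om := ball_volume.

Lemma ball_volume_ge0 m s : 0 <= Om m s.
Proof. by apply: integral_ge0 => t _; exact: le_ind_ge0. Qed.

Lemma measurable_ball_volume m : measurable_fun [set: R] (Om m).
Proof.
have := measurable_fun_fubini_tonelli_F (m2 := T_ m)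
  (fun z : (R * m.-tuple mR)%type => le_ind (sqnorm z.2) z.1).
apply=> [|z]; last exact: le_ind_ge0.
apply: measurable_le_ind; last exact: measurable_fst.
exact: (measurableT_comp (@measurable_sqnorm _ m) measurable_snd).
Qed.

Lemma ball_volume_lt0 m s : (s < 0)%R -> Om m s = 0.
Proof.
move=> s0; apply: integral0_eq => t _; rewrite /le_ind.
by rewrite leNgt (lt_le_trans s0)// sqnorm_ge0.
Qed.

Lemma le_ind_addl x y s : le_ind (x + y)%R s = le_ind y (s - x)%R.
Proof. by rewrite /le_ind lerBrDl. Qed.

Lemma ball_volumeS m s : Om m.+1 s = \int[leb]_x Om m (s - x ^+ 2)%R.
Proof.
rewrite /Om (integral_radialS _ (F := fun x => le_ind x s))//.
- apply: eq_integral => x _; apply: eq_integral => t _; exact: le_ind_addl.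
- exact: measurable_le_ind.
- by move=> x; exact: le_ind_ge0.
Qed.

Lemma ball_volume0 s : (0 <= s)%R -> Om 0 s = 1.
Proof.
by move=> s0; rewrite /Om integral_tuple0 /le_ind /sqnorm big_ord0 s0.
Qed.

(** A ball of radius 0 has nonempty slices only over a single point, a null
set. *)
Lemma ball_volumeS0 m : Om m.+1 0%R = 0.
Proof.
rewrite ball_volumeS -(integral_set1 (fun x => Om m (0 - x ^+ 2)%R) 0%R).
rewrite [RHS]integral_mkcond; apply: eq_integral => x _.
rewrite patchE; case: ifPn => //; rewrite notin_setE/= => /eqP x0.
by rewrite ball_volume_lt0// sub0r oppr_lt0 exprn_even_gt0.
Qed.

(** Homogeneity, by induction on the dimension: slicing turns a ball into balls
of the previous dimension, and the variable of the slices is rescaled. *)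
Lemma ball_volume_scale m (r : R) : (0 <= r)%R -> Om m (r ^+ 2)%R = (r ^+ m)%:E * Om m 1%R.
Proof.
elim: m r => [|m IH] r r0.
  by rewrite !ball_volume0 ?mule1// ?sqr_ge0.
have [->|rn0] := eqVneq r 0%R.
  by rewrite !expr0n/= ball_volumeS0 mul0e.
have {r0 rn0}r0 : (0 < r)%R by rewrite lt_neqAle eq_sym rn0.
have m1 (c : R) : measurable_fun [set: R] (fun x : R => Om m (c - x ^+ 2)%R).
  apply: (measurableT_comp (f := Om m)); first exact: measurable_ball_volume.
  by apply: measurable_funB => //; exact: measurable_funX.
rewrite ball_volumeS (integral_scale r0)//; last by move=> x; exact: ball_volume_ge0.
rewrite ball_volumeS (exprS r m) EFinM -muleA; congr (_ * _).
have f0 x : 0 <= Om m (1 - x ^+ 2)%R by exact: ball_volume_ge0.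
have rm0 : (0 <= r ^+ m)%R by exact/exprn_ge0/ltW.
rewrite -(ge0_integralZl_EFin leb measurableT (fun x _ => f0 x) (m1 1%R) rm0).
apply: eq_integral => x _.
have -> : (r ^+ 2 - (r * x) ^+ 2 = r ^+ 2 * (1 - x ^+ 2))%R by ring.
have [x1|x1] := leP 0%R (1 - x ^+ 2)%R; last first.
  rewrite !ball_volume_lt0 ?mule0//.
  by rewrite pmulr_rlt0// exprn_gt0.
rewrite -[X in (_ * X)%R](sqr_sqrtr x1) -exprMn IH ?mulr_ge0 ?sqrtr_ge0 ?(ltW r0)//.
by rewrite -[X in _ = _ * Om m X](sqr_sqrtr x1) IH ?sqrtr_ge0// exprMn EFinM muleA.
Qed.

End balls.

(** * The Gaussian integral in layers *)

Section gauss.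
Context {R : realType}.
Local Notation leb := (@lebesgue_measure R).
Local Notation mR := (measurableTypeR R).
Local Notation T_ n := (tuple_measure leb n).
Local Open Scope ereal_scope.
Local Notation Om := (@ball_volume R).

Lemma integral_expRN_tail (c : R) :
  \int[leb]_(s in `[c, +oo[) (expR (- s))%:E = (expR (- c))%:E.
Proof.
rewrite (@ge0_continuous_FTC2y _ _ (fun s => - expR (- s))%R _ 0%R).
- by rewrite sub0e -EFinN opprK.
- by move=> x _; exact: expR_ge0.
- apply: continuous_subspaceT => x.
  by apply: continuous_comp; [exact: opp_continuous|exact: continuous_expR].
- rewrite -oppr0; apply: cvgN; exact: cvgr_expR.
- by move=> x _; apply: derivableN; apply: ex_derive.
- apply: cvgN; apply: cvg_at_right_filter.
  by apply: continuous_comp; [exact: opp_continuous|exact: continuous_expR].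
- move=> x _; rewrite derive1E deriveN; last exact: ex_derive.
  have := (is_derive1_comp (is_derive_expR (- x)%R) (is_deriveNid x 1%R)).
  move=> h; rewrite (@derive_val _ _ _ _ _ _ _ h).
  by rewrite mulrN1 opprK.
Qed.

Lemma integral_gauss_radial m :
  \int[T_ m]_t (expR (- sqnorm t))%:E = (Num.sqrt pi ^+ m)%:E.
Proof.
have mE (c : R) : measurable_fun [set: R] (fun s : R => (expR (- (c + s)))%:E).
  apply/measurable_EFinP; apply: measurableT_comp => //.
  by apply: measurableT_comp => //; exact: measurable_funD.
elim: m => [|m IH].
  by rewrite integral_tuple0 /sqnorm big_ord0 oppr0 expR0.
have mG : measurable_fun [set: m.-tuple mR]
    (fun t : m.-tuple mR => (expR (- sqnorm t))%:E).
  apply: (@measurable_radial _ m (fun s => (expR (- s))%:E)).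
  by apply/measurable_EFinP; apply: measurableT_comp.
rewrite (integral_radialS _ (F := fun s => (expR (- s))%:E)); last 2 first.
- by apply/measurable_EFinP; apply: measurableT_comp.
- by move=> s; rewrite lee_fin expR_ge0.
under eq_integral => x _.
  under eq_integral => t _ do rewrite opprD expRD EFinM.
  rewrite (ge0_integralZl_EFin _ measurableT _ mG (expR_ge0 _)); last first.
    by move=> t _; rewrite lee_fin expR_ge0.
  rewrite IH.
  over.
rewrite exprS EFinM.
have g0 x : 0 <= (gauss_fun x : R)%:E by rewrite lee_fin gauss_fun_ge0.
rewrite -integralT_gauss.
rewrite -ge0_integralZr//.
by apply/measurable_EFinP; exact: measurable_gauss_fun.
Qed.

(** The integral defining Gamma(m/2+1), kept in the extended reals until
[ball_gamma_fin] shows that it is finite. *)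
Definition gamma_half m : \bar R :=
  \int[leb]_(s in `]0%R, +oo[) (s `^ (m%:R / 2) * expR (- s))%:E.

Lemma gamma_half_ge0 m : 0 <= gamma_half m.
Proof.
by apply: integral_ge0 => s _; rewrite lee_fin mulr_ge0 ?powR_ge0 ?expR_ge0.
Qed.

(** The Gaussian integral over R^m computed twice: coordinate by coordinate, and in
layers, writing exp(-|x|^2) as the integral of exp(-s) over s >= |x|^2. *)
Lemma ball_volume_gamma m : Om m 1%R * gamma_half m = (Num.sqrt pi ^+ m)%:E.
Proof.
rewrite -integral_gauss_radial.
pose h (z : m.-tuple mR * R) := le_ind (sqnorm z.1) z.2 * (expR (- z.2))%:E.
have h0 z : 0 <= h z by rewrite mule_ge0 ?le_ind_ge0 ?lee_fin ?expR_ge0.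
have mh : measurable_fun [set: (m.-tuple mR * R)%type] h.
  apply: emeasurable_funM.
    apply: measurable_le_ind; last exact: measurable_snd.
    exact: (measurableT_comp (@measurable_sqnorm _ m) measurable_fst).
  apply/measurable_EFinP; apply: measurableT_comp => //.
  by apply: measurableT_comp => //; exact: measurable_snd.
have -> : \int[T_ m]_t (expR (- sqnorm t))%:E = \int[T_ m]_t \int[leb]_s h (t, s).
  apply: eq_integral => t _; rewrite -integral_expRN_tail integral_mkcond.
  apply: eq_integral => s _; rewrite patchE /h/= /le_ind mem_setE in_itv/= andbT.
  by case: ifPn => _; rewrite ?mul1e ?mul0e.
rewrite (fubini_tonelli (m1 := T_ m) (m2 := leb) _ mh h0).
have mp : measurable_fun [set: R] (fun s : R => (s `^ (m%:R / 2) * expR (- s))%:E).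
  apply/measurable_EFinP; apply: measurable_funM; first exact: measurable_powR.
  by apply: measurableT_comp.
rewrite /gamma_half integral_itv_obnd_cbnd; last exact: measurable_funTS.
rewrite -(ge0_integralZl leb _ (measurable_funTS mp))//; last 2 first.
- by move=> s _; rewrite lee_fin mulr_ge0 ?powR_ge0 ?expR_ge0.
- exact: ball_volume_ge0.
rewrite integral_mkcond; apply: eq_integral => s _.
rewrite patchE mem_setE in_itv/= andbT.
have mi : measurable_fun [set: m.-tuple mR]
    (fun t : m.-tuple mR => le_ind (sqnorm t) s).
  by apply: measurable_le_ind => //; exact: measurable_sqnorm.
rewrite /h/= (ge0_integralZr _ measurableT mi); last 2 first.
- by move=> t _; exact: le_ind_ge0.
- by rewrite lee_fin expR_ge0.
rewrite -/(Om m s); case: ifPn => s0; last first.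
  by rewrite ball_volume_lt0 ?mul0e// ltNge.
rewrite EFinM muleA; congr (_ * _); rewrite muleC.
rewrite -{2}(sqr_sqrtr s0) ball_volume_scale ?sqrtr_ge0//.
rewrite mulrC powRrM (powR_mulrn _ (powR_ge0 _ _)).
by rewrite powR12_sqrt.
Qed.

End gauss.

(** * The functional equation of Gamma *)

Section gamma_recursion.
Context {R : realType}.
Local Notation leb := (@lebesgue_measure R).
Local Open Scope ereal_scope.

Lemma continuous_powR (a x : R) : (0 < x)%R -> {for x, continuous (fun y : R => (y `^ a)%R : R)}.
Proof.
move=> x0; apply: differentiable_continuous; apply/derivable1_diffP.
by apply: derivable_powR; rewrite in_itv/= andbT.
Qed.

Lemma powR_cvg_right0 (a : R) : (0 <= a)%R ->
  (s `^ a)%R @[s --> (0:R)^'+] --> (0 `^ a)%R.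
Proof.
rewrite le_eqVlt => /predU1P[<-|a0].
  rewrite powRr0; under eq_fun do rewrite powRr0; exact: cvg_cst.
by rewrite powR0 ?gt_eqF//; exact: powR_cvg0.
Qed.

Lemma powR_LRcontinuous (a t : R) : (0 <= a)%R -> (0 < t)%R ->
  derivable_oo_LRcontinuous (fun y : R => (y `^ a)%R : R) 0%R t.
Proof.
move=> a0 t0; split.
- by move=> x; rewrite in_itv/= => /andP[x0 _]; apply: derivable_powR;
    rewrite in_itv/= andbT.
- exact: powR_cvg_right0.
- by apply: cvg_at_left_filter; exact: continuous_powR.
Qed.

Lemma integral_powR (a t : R) : (0 <= a)%R -> (0 <= t)%R ->
  \int[leb]_(s in `[0%R, t]) ((a + 1) * s `^ a)%:E = (t `^ (a + 1))%:E.
Proof.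
move=> a0; have a1 : (0 < a + 1)%R by rewrite ltr_wpDl.
rewrite le_eqVlt => /predU1P[<-|t0].
  by rewrite set_itv1 integral_set1 powR0// gt_eqF.
rewrite (@continuous_FTC2 _ _ (fun y : R => (y `^ (a + 1))%R : R))//.
- by rewrite powR0 ?gt_eqF// sube0.
- apply: derivable_oo_LRcontinuous_within; split.
  + move=> x; rewrite in_itv/= => /andP[x0 _]; apply: derivableM => //.
    by apply: derivable_powR; rewrite in_itv/= andbT.
  + by apply: cvgM; [exact: cvg_cst|exact: powR_cvg_right0].
  + apply: cvgM; first exact: cvg_cst.
    by apply: cvg_at_left_filter; exact: continuous_powR.
- by apply: powR_LRcontinuous => //; exact: ltW.
- move=> x; rewrite in_itv/= => /andP[x0 _].
  by rewrite powR_derive1 ?in_itv/= ?andbT// addrK.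
Qed.

(** Gamma(a+2) = (a+1) Gamma(a+1), by Tonelli: t^(a+1) is the integral of
(a+1) s^a over 0 <= s <= t, and exp(-s) the integral of exp(-t) over t >= s.
Every integrand is nonnegative. *)
Lemma integral_powR_expR (a : R) : (0 <= a)%R ->
  \int[leb]_(t in `]0%R, +oo[) (t `^ (a + 1) * expR (- t))%:E =
  (a + 1)%:E * \int[leb]_(t in `]0%R, +oo[) (t `^ a * expR (- t))%:E.
Proof.
move=> a0; have a1 : (0 < a + 1)%R by rewrite ltr_wpDl.
have mp b : measurable_fun [set: R] (fun s : R => (s `^ b * expR (- s))%:E).
  apply/measurable_EFinP; apply: measurable_funM; first exact: measurable_powR.
  by apply: measurableT_comp.
have p0 b (s : R) : 0 <= (s `^ b * expR (- s))%:E.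
  by rewrite lee_fin mulr_ge0 ?powR_ge0 ?expR_ge0.
rewrite !integral_itv_obnd_cbnd; [|exact: measurable_funTS..].
pose h (z : R * R) :=
  le_ind 0 z.1 * le_ind z.1 z.2 * ((a + 1) * z.1 `^ a * expR (- z.2))%:E.
have h0 z : 0 <= h z.
  rewrite mule_ge0 ?mule_ge0 ?le_ind_ge0// lee_fin.
  by rewrite !mulr_ge0 ?powR_ge0 ?expR_ge0// ltW.
have mh : measurable_fun [set: (R * R)%type] h.
  apply: emeasurable_funM; first apply: emeasurable_funM.
  - by apply: measurable_le_ind => //; exact: measurable_fst.
  - by apply: measurable_le_ind; [exact: measurable_fst|exact: measurable_snd].
  apply/measurable_EFinP; apply: measurable_funM.
    apply: measurable_funM => //.
    exact: (measurableT_comp (@measurable_powR R a) measurable_fst).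
  apply: measurableT_comp => //.
  by apply: measurableT_comp => //; exact: measurable_snd.
have me : measurable_fun [set: R] (fun t : R => (expR (- t))%:E).
  by apply/measurable_EFinP; apply: measurableT_comp.
have e0 (t : R) : 0 <= (expR (- t))%:E by rewrite lee_fin expR_ge0.
transitivity (\int[leb]_t \int[leb]_s h (s, t)); last first.
  rewrite -(fubini_tonelli (m1 := leb) (m2 := leb) _ mh h0).
  rewrite -(ge0_integralZl_EFin leb (measurable_itv `[0%R, +oo[)
    (fun x _ => p0 a x) (measurable_funTS (mp a)) (ltW a1)).
  rewrite [RHS]integral_mkcond; apply: eq_integral => s _.
  rewrite patchE mem_setE in_itv/= andbT.
  case: ifPn => s0; last first.
    apply: integral0_eq => t _.
    by rewrite /h/= {1}/le_ind (negbTE s0) !mul0e.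
  rewrite -EFinM mulrA EFinM -integral_expRN_tail.
  have c0 : (0 <= (a + 1) * s `^ a)%R by rewrite mulr_ge0 ?powR_ge0 ?ltW.
  rewrite -(ge0_integralZl_EFin leb (measurable_itv `[s, +oo[)
    (fun t _ => e0 t) (measurable_funTS me) c0).
  rewrite [RHS]integral_mkcond; apply: eq_integral => t _.
  rewrite patchE mem_setE in_itv/= andbT /h/= /le_ind s0 mul1e.
  by case: ifPn => _; rewrite ?mul1e ?mul0e// EFinM.
rewrite integral_mkcond; apply: eq_integral => t _.
rewrite patchE mem_setE in_itv/= andbT.
case: ifPn => t0; last first.
  apply/esym/integral0_eq => s _; rewrite /h/= /le_ind.
  case: (leP 0%R s) => s0; rewrite ?mul0e// mul1e.
  by rewrite leNgt (lt_le_trans _ s0) ?mul0e// ltNge.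
have mq : measurable_fun [set: R] (fun s : R => ((a + 1) * s `^ a)%:E).
  by apply/measurable_EFinP; apply: measurable_funM.
have q0 (s : R) : 0 <= ((a + 1) * s `^ a)%:E.
  by rewrite lee_fin mulr_ge0 ?powR_ge0// ltW.
rewrite EFinM -integral_powR//.
rewrite -(ge0_integralZr leb (measurable_itv `[0%R, t]) (measurable_funTS mq)
  (fun s _ => q0 s) (e0 t)).
rewrite integral_mkcond; apply: eq_integral => s _.
rewrite patchE mem_setE in_itv/= /h/= /le_ind.
by case: (leP 0%R s); case: (leP s t); rewrite /= ?mul1e ?mul0e ?EFinM.
Qed.

Lemma gamma_halfS2 m :
  gamma_half m.+2 = (m%:R / 2 + 1 : R)%:E * gamma_half m.
Proof.
rewrite /gamma_half -integral_powR_expR ?divr_ge0//.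
by rewrite -addn2 natrD mulrDl divff// pnatr_eq0.
Qed.

End gamma_recursion.

(** * The neighbourhood of a flat disc *)

Section kappa.
Context {R : realType}.
Local Notation leb := (@lebesgue_measure R).
Local Notation mR := (measurableTypeR R).
Local Notation T_ n := (tuple_measure leb n).
Local Open Scope ereal_scope.
Local Notation Om := (@ball_volume R).

Definition kappa m : R := fine (Om m 1%R).

Lemma sqrt_pi_gt0 : (0 < Num.sqrt pi :> R)%R.
Proof. by rewrite sqrtr_gt0 pi_gt0. Qed.

(** Two nonnegative extended reals whose product is finite and positive are both
finite and positive. *)
Lemma ball_gamma_fin m :
  [/\ Om m 1%R \is a fin_num, 0 < Om m 1%R,
      gamma_half m \is a (@fin_num R) & 0 < gamma_half m :> \bar R].
Proof.
have c0 : (0 < Num.sqrt pi ^+ m :> R)%R by rewrite exprn_gt0// sqrt_pi_gt0.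
have := ball_volume_gamma (R := R) m.
have := ball_volume_ge0 m (1 : R)%R.
have := @gamma_half_ge0 R m.
case: (Om m 1%R) => [x| |]; case: (gamma_half m) => [y| |] //.
- rewrite !lee_fin -EFinM => y0 x0 [] xy; rewrite !lte_fin.
  have : (0 < x * y)%R by rewrite xy.
  move: y0 x0; rewrite !le_eqVlt => /predU1P[<-|y0]; first by rewrite mulr0 ltxx.
  by move=> /predU1P[<-|x0]; first by rewrite mul0r ltxx.
- move=> _; rewrite lee_fin le_eqVlt => /predU1P[<-|x0].
    by rewrite mul0e => -[] h; move: c0; rewrite -h ltxx.
  by rewrite gt0_muley.
- rewrite lee_fin le_eqVlt => /predU1P[<-|y0] _.
    by rewrite mule0 => -[] h; move: c0; rewrite -h ltxx.
  by rewrite gt0_mulye.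
Qed.

Lemma ball_volume1 m : Om m 1%R = (kappa m)%:E.
Proof. by rewrite fineK//; case: (ball_gamma_fin m). Qed.

Lemma kappa_gt0 m : (0 < kappa m)%R.
Proof. by have [_ + _ _] := ball_gamma_fin m; rewrite ball_volume1 lte_fin. Qed.

Lemma gamma_halfE m : gamma_half m = (Gamma (m%:R / 2 + 1 : R))%:E.
Proof.
have [_ _ gf _] := ball_gamma_fin m.
rewrite /Gamma /Rintegral -(fineK gf); congr (_%:E).
by congr fine; apply: eq_integral => x _; rewrite addrK.
Qed.

Lemma Gamma_half_gt0 m : (0 < Gamma (m%:R / 2 + 1 : R))%R.
Proof. by have [_ _ _] := ball_gamma_fin m; rewrite gamma_halfE lte_fin. Qed.

Lemma Gamma_halfS2 m :
  (Gamma (m.+2%:R / 2 + 1 : R) = (m%:R / 2 + 1) * Gamma (m%:R / 2 + 1))%R.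
Proof.
by apply/EFin_inj; rewrite -gamma_halfE gamma_halfS2 gamma_halfE -EFinM.
Qed.

Lemma kappa_Gamma m :
  (kappa m * Gamma (m%:R / 2 + 1 : R) = Num.sqrt pi ^+ m)%R.
Proof.
apply/EFin_inj; rewrite -ball_volume_gamma gamma_halfE ball_volume1.
by rewrite EFinM.
Qed.

Lemma kappaS2 m : (kappa m.+2 * (m%:R / 2 + 1) = pi * kappa m)%R.
Proof.
have G0 := lt0r_neq0 (Gamma_half_gt0 m).
apply: (mulIf G0); rewrite -!mulrA -Gamma_halfS2 !kappa_Gamma.
by rewrite -addn2 exprD sqr_sqrtr ?pi_ge0// mulrC.
Qed.

Lemma ball_volumeE m (r : R) : (0 <= r)%R ->
  Om m (r ^+ 2)%R = (r ^+ m * kappa m)%:E.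
Proof. by move=> r0; rewrite ball_volume_scale// ball_volume1 EFinM. Qed.

Lemma ball_volume_le_ind m (s : R) :
  Om m s = le_ind 0 s * (Num.sqrt s ^+ m * kappa m)%:E.
Proof.
rewrite /le_ind; case: (leP 0%R s) => s0; last first.
  by rewrite mul0e ball_volume_lt0.
by rewrite mul1e -{1}(sqr_sqrtr s0) ball_volumeE ?sqrtr_ge0.
Qed.

Lemma sqnorm_split n q (t : (n + q).-tuple mR) :
  sqnorm t = (sqhead t + sqtail t)%R.
Proof. exact: big_split_ord. Qed.

Lemma measurable_sqrt_sub (c : R) :
  measurable_fun [set: R] (fun x : R => Num.sqrt (c - x) : R).
Proof.
apply: (measurableT_comp (f := @Num.sqrt R)).
  by apply: continuous_measurable_fun; exact: sqrt_continuous.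
exact: measurable_funB.
Qed.

Lemma measurable_sqrt_pow q k (t : R) :
  measurable_fun [set: q.-tuple mR] (fun y : q.-tuple mR =>
    le_ind (sqnorm y) (t ^+ 2) * (Num.sqrt (t ^+ 2 - sqnorm y) ^+ k)%:E).
Proof.
apply: (@measurable_radial _ q
  (fun s => le_ind s (t ^+ 2) * (Num.sqrt (t ^+ 2 - s) ^+ k)%:E)).
apply: emeasurable_funM; first exact: measurable_le_ind.
by apply/measurable_EFinP; apply: measurable_funX; exact: measurable_sqrt_sub.
Qed.

Lemma sqrt_pow_ge0 q k (t : R) (y : q.-tuple mR) :
  0 <= le_ind (sqnorm y) (t ^+ 2) * (Num.sqrt (t ^+ 2 - sqnorm y) ^+ k)%:E.
Proof. by rewrite mule_ge0 ?le_ind_ge0// lee_fin exprn_ge0// sqrtr_ge0. Qed.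

(** The fibres of a (q+k)-ball over its q-dimensional section are k-balls of radius
sqrt(t^2 - |y|^2), of volume kappa_k sqrt(t^2 - |y|^2)^k. *)
Lemma integral_sqrt_pow q k (t : R) : (0 <= t)%R ->
  \int[T_ q]_y (le_ind (sqnorm y) (t ^+ 2)
     * (Num.sqrt (t ^+ 2 - sqnorm y) ^+ k)%:E) =
  (t ^+ (q + k) * (kappa (q + k) / kappa k))%:E.
Proof.
move=> t0; have k0 := kappa_gt0 k.
have mI := @measurable_sqrt_pow q k t; have I0 := @sqrt_pow_ge0 q k t.
have : Om (q + k) (t ^+ 2)%R = (kappa k)%:E * \int[T_ q]_y (le_ind (sqnorm y) (t ^+ 2)
     * (Num.sqrt (t ^+ 2 - sqnorm y) ^+ k)%:E).
  rewrite -(ge0_integralZl_EFin (T_ q) measurableT (fun x _ => I0 x) mI (ltW k0)).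
  transitivity (\int[T_ (q + k)]_z le_ind (sqhead z + sqtail z) (t ^+ 2)).
    by apply: eq_integral => z _; rewrite sqnorm_split.
  rewrite (@integral_head_tail _ q k (fun s => le_ind (s.1 + s.2) (t ^+ 2)))/=.
  - apply: eq_integral => y _.
    under eq_integral do rewrite le_ind_addl.
    rewrite -/(Om k (t ^+ 2 - sqnorm y)) ball_volume_le_ind.
    by rewrite [RHS]muleCA /le_ind subr_ge0 mulrC EFinM.
  - apply: measurable_le_ind => //.
    by apply: measurable_funD; [exact: measurable_fst|exact: measurable_snd].
  - by move=> s; exact: le_ind_ge0.
rewrite ball_volumeE// => h.
rewrite -[LHS]mul1e -[X in X%:E * _](mulVf (lt0r_neq0 k0)) EFinM -muleA -h -EFinM.
by rewrite mulrC mulrA.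
Qed.

(** The t-neighbourhood of the flat disc B^n x {0}: the point of the disc nearest
to (x, y) is x scaled back into B^n. *)
Definition disc_parallel n q (t : R) : set ((n + q).-tuple mR) :=
  [set z | (sqtail z <= t ^+ 2)%R /\
           (sqhead z <= (1 + Num.sqrt (t ^+ 2 - sqtail z)) ^+ 2)%R].

Definition disc_poly n q : {poly R} :=
  (\sum_(k < n.+1) ('C(n, k)%:R * kappa n * (kappa (q + k) / kappa k)) *: 'X^(q + k))%R.

(** Over y in R^q the neighbourhood is an n-ball of radius 1 + sqrt(t^2 - |y|^2);
expand its volume with the binomial formula. *)
Lemma volume_disc_parallel n q (t : R) : (0 <= t)%R ->
  T_ (n + q) (@disc_parallel n q t) = ((disc_poly n q).[t])%:E.
Proof.
move=> t0.
pose F (s : R * R) := le_ind s.2 (t ^+ 2)%R *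
  le_ind s.1 ((1 + Num.sqrt (t ^+ 2 - s.2)) ^+ 2)%R.
have mF : measurable_fun [set: R * R] F.
  apply: emeasurable_funM; first by apply: measurable_le_ind => //; exact: measurable_snd.
  apply: measurable_le_ind; first exact: measurable_fst.
  apply: measurable_funX; apply: measurable_funD => //.
  exact: (measurableT_comp (@measurable_sqrt_sub (t ^+ 2)%R) measurable_snd).
have F0 s : 0 <= F s by rewrite mule_ge0 ?le_ind_ge0.
have -> : T_ (n + q) (@disc_parallel n q t) =
    \int[T_ (n + q)]_z F (sqhead z, sqtail z).
  have mFz : measurable_fun [set: (n + q).-tuple mR]
      (fun z : (n + q).-tuple mR => F (sqhead z, sqtail z)).
    apply: (measurableT_comp (f := F)
      (g := fun z : (n + q).-tuple mR => (sqhead z, sqtail z))) => //.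
    by apply/measurable_fun_pairP; split;
      [exact: measurable_sqhead|exact: measurable_sqtail].
  have FE z : F (sqhead z, sqtail z) = (\1_(@disc_parallel n q t) z)%:E.
    rewrite /F /le_ind/= -EFinM -natrM mulnb indicE; congr ((_%:R)%:E).
    congr nat_of_bool; apply/idP/idP.
      by move=> /andP[h1 h2]; rewrite inE; split.
    by rewrite inE => -[h1 h2]; rewrite h1 h2.
  have mD : measurable (@disc_parallel n q t).
    apply/(measurable_indicP R); apply/measurable_EFinP.
    rewrite (_ : EFin \o _ = fun z => F (sqhead z, sqtail z))//.
    by apply/funext => z; rewrite FE.
  under eq_integral do rewrite FE.
  by rewrite integral_indic// setIT.
rewrite integral_head_tail//.
rewrite (fubini_tonelli (m1 := T_ n) (m2 := T_ q) _
   (measurable_pair_radial mF) (fun=> F0 _)).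
transitivity (\int[T_ q]_y (\sum_(k < n.+1) ('C(n, k)%:R * kappa n)%:E *
   (le_ind (sqnorm y) (t ^+ 2) * (Num.sqrt (t ^+ 2 - sqnorm y) ^+ k)%:E))).
  apply: eq_integral => y _ /=.
  rewrite /F/= ge0_integralZl//.
  - rewrite -/(Om n _) ball_volumeE; last by rewrite addr_ge0 ?sqrtr_ge0.
    rewrite exprDn mulr_suml -sumEFin ge0_sume_distrr; last first.
      move=> i _; rewrite lee_fin expr1n mul1r.
      by rewrite mulr_ge0 ?(ltW (kappa_gt0 _))// mulrn_wge0// exprn_ge0 ?sqrtr_ge0.
    apply: eq_bigr => k _; rewrite expr1n mul1r [RHS]muleCA; congr (_ * _).
    by rewrite -EFinM -mulr_natl mulrAC.
  - by apply: measurable_le_ind => //; exact: measurable_sqnorm.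
  - by move=> x _; exact: le_ind_ge0.
  - exact: le_ind_ge0.
have mI k := @measurable_sqrt_pow q k t; have I0 k := @sqrt_pow_ge0 q k t.
have c0 k : (0 <= 'C(n, k)%:R * kappa n)%R by rewrite mulr_ge0// ltW// kappa_gt0.
rewrite ge0_integral_sum//; last 2 first.
- move=> k; exact: (emeasurable_funM (@measurable_cst _ _ _ _ setT _) (mI k)).
- by move=> k y _; rewrite mule_ge0 ?lee_fin.
rewrite horner_sum -sumEFin; apply: eq_bigr => k _.
rewrite (ge0_integralZl_EFin (T_ q) measurableT (fun x _ => I0 k x) (mI k) (c0 k)).
rewrite integral_sqrt_pow// -EFinM hornerZ hornerXn; congr (_%:E).
by move: (kappa (q + k) / kappa k)%R => c; ring.
Qed.

End kappa.

(** * Sandwiching the parallel body of an ellipsoid *)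

Section euclid_sums.
Context {R : rcfType}.

Lemma sum_CauchySchwarz m (f g : 'I_m -> R) :
  (\sum_i f i * g i) ^+ 2 <= (\sum_i f i ^+ 2) * (\sum_i g i ^+ 2).
Proof.
set P := \sum_i f i * g i; set S := \sum_i _; set T := \sum_i _.
have T0 : 0 <= T by apply: sumr_ge0 => i _; exact: sqr_ge0.
have : 0 <= \sum_i (T * f i - P * g i) ^+ 2 by apply: sumr_ge0 => i _; exact: sqr_ge0.
have -> : \sum_i (T * f i - P * g i) ^+ 2 = T * (S * T - P ^+ 2).
  transitivity (\sum_i (T ^+ 2 * f i ^+ 2 - (T * P * 2) * (f i * g i) + P ^+ 2 * g i ^+ 2)).
    by apply: eq_bigr => i _; ring.
  rewrite big_split/= sumrB -!mulr_sumr -/P -/S -/T; ring.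
have [T_eq0|T_neq0] := eqVneq T 0.
  have P0 : P = 0.
    apply: big1 => i _; suff -> : g i = 0 by rewrite mulr0.
    apply/eqP; rewrite -sqrf_eq0; apply/eqP.
    by apply: (psumr_eq0P (P := predT) _ T_eq0) => // j _; exact: sqr_ge0.
  by rewrite P0 T_eq0 expr0n/= mulr0.
by rewrite pmulr_rge0 ?subr_ge0// lt_neqAle eq_sym T_neq0.
Qed.

Lemma sum_Minkowski m (f g : 'I_m -> R) :
  \sum_i (f i + g i) ^+ 2 <=
  (Num.sqrt (\sum_i f i ^+ 2) + Num.sqrt (\sum_i g i ^+ 2)) ^+ 2.
Proof.
have S0 (h : 'I_m -> R) : 0 <= \sum_i h i ^+ 2.
  by apply: sumr_ge0 => i _; exact: sqr_ge0.
rewrite sqrrD !sqr_sqrtr// -sqrtrM//.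
have -> : \sum_i (f i + g i) ^+ 2 =
    \sum_i f i ^+ 2 + (\sum_i f i * g i) *+ 2 + \sum_i g i ^+ 2.
  by rewrite -sumrMnl -!big_split/=; apply: eq_bigr => i _; rewrite sqrrD.
rewrite lerD2r lerD2l lerMn2r/=; apply: le_trans (ler_norm _) _.
rewrite -sqrtr_sqr ler_sqrt; first exact: sum_CauchySchwarz.
by rewrite mulr_ge0.
Qed.

End euclid_sums.

Section sandwich.
Context {R : realType}.
Local Notation leb := (@lebesgue_measure R).
Local Notation mR := (measurableTypeR R).
Local Notation T_ n := (tuple_measure leb n).

Lemma semiaxis_head n q (eps : R) (i : 'I_n) : semiaxis n q eps (lshift q i) = 1.
Proof. by rewrite /semiaxis/= ltn_ord. Qed.

Lemma semiaxis_tail n q (eps : R) (i : 'I_q) : semiaxis n q eps (rshift n i) = eps.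
Proof. by rewrite /semiaxis/= ltnNge leq_addr. Qed.

(** The nearest point of the flat disc lies in the ellipsoid, whatever eps. *)
Lemma disc_parallel_sub n q (eps t : R) (z : (n + q).-tuple mR) : 0 < t ->
  @disc_parallel R n q t z ->
  parallel_body (ellipsoid n q eps) t (\row_i tnth z i).
Proof.
move=> t0 [zt zh].
set a := sqhead z; set b := sqtail z.
have a0 : 0 <= a by apply: sumr_ge0 => i _; exact: sqr_ge0.
(* The head of z multiplied by c is the point of B^n nearest to it. *)
pose c : R := if a <= 1 then 1 else (Num.sqrt a)^-1.
pose u : 'rV[R]_(n + q) := \row_j (if (j < n)%N then c * tnth z j else 0).
have uh i : u ord0 (lshift q i) = c * tnth z (lshift q i) by rewrite mxE/= ltn_ord.
have ut i : u ord0 (rshift n i) = 0 by rewrite mxE/= ltnNge leq_addr.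
exists u.
  rewrite /ellipsoid/= big_split_ord/=.
  under eq_bigr do rewrite semiaxis_head uh divr1 exprMn.
  under [X in _ + X]eq_bigr do rewrite ut mul0r expr0n/=.
  rewrite big1_eq addr0 -mulr_sumr -/(sqhead z) -/a /c.
  case: ifPn => [a1|]; first by rewrite expr1n mul1r.
  rewrite -ltNge => a1.
  by rewrite exprVn sqr_sqrtr// mulVf// gt_eqF// (lt_trans _ a1).
exists (t^-1 *: ((\row_i tnth z i) - u)); last first.
  by rewrite scalerA divff ?gt_eqF// scale1r addrC subrK.
rewrite /euclidean_ball/=.
under eq_bigr do rewrite mxE exprMn.
rewrite -mulr_sumr exprVn mulrC ler_pdivrMr ?exprn_gt0// mul1r.
rewrite big_split_ord/=.
under eq_bigr => i _ do rewrite mxE [in X in _ + X]mxE uh mxE -[X in X - _]mul1r -mulrBl exprMn.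
under [X in _ + X]eq_bigr => i _ do rewrite mxE [in X in _ + X]mxE ut mxE subr0.
rewrite -mulr_sumr -/(sqhead z) -/(sqtail z) -/a -/b /c.
case: ifPn => [a1|]; first by rewrite subrr expr0n/= mul0r add0r.
rewrite -ltNge => a1.
have sa1 : 1 < Num.sqrt a by rewrite -[X in X < _]sqrtr1 ltr_sqrt// (lt_trans _ a1).
have sa0 : Num.sqrt a != 0 by rewrite gt_eqF// (lt_trans _ sa1).
rewrite -{2}(sqr_sqrtr a0) -exprMn mulrBl mul1r mulVf// -lerBrDr.
have sa2 : 0 <= Num.sqrt a - 1 by rewrite subr_ge0 ltW.
rewrite -[leRHS]sqr_sqrtr ?subr_ge0// ler_sqr ?nnegrE ?sqrtr_ge0//.
rewrite lerBlDl -[leRHS]ger0_norm ?addr_ge0 ?sqrtr_ge0// -sqrtr_sqr ler_sqrt ?sqr_ge0//.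
Qed.

(** The ellipsoid is contained in the eps-neighbourhood of the flat disc; the
triangle inequality is applied to the two blocks of coordinates separately. *)
Lemma parallel_body_sub n q (eps t : R) (z : (n + q).-tuple mR) :
  0 < eps -> 0 <= t ->
  parallel_body (ellipsoid n q eps) t (\row_i tnth z i) ->
  @disc_parallel R n q (t + eps) z.
Proof.
move=> e0 t0 [u + [w + uw]].
rewrite /ellipsoid/euclidean_ball/= !big_split_ord/=.
under eq_bigr do rewrite semiaxis_head divr1.
under [X in _ + X]eq_bigr do rewrite semiaxis_tail exprMn.
rewrite -mulr_suml.
set A := \sum_i _; set A2 := \sum_i _ => hA.
set B := \sum_i _; set B2 := \sum_i _ => hB.
have S0 m (h : 'I_m -> R) : 0 <= \sum_i h i ^+ 2.
  by apply: sumr_ge0 => i _; exact: sqr_ge0.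
have [A0 A20 B0 B20] : [/\ 0 <= A, 0 <= A2, 0 <= B & 0 <= B2] by rewrite !S0.
have zE i : tnth z i = u ord0 i + t * w ord0 i.
  by have := congr1 (fun M : 'rV[R]_(n + q) => M ord0 i) uw; rewrite !mxE.
have tw m (h : 'I_m -> R) : Num.sqrt (\sum_i (t * h i) ^+ 2) = t * Num.sqrt (\sum_i h i ^+ 2).
  under eq_bigr do rewrite exprMn.
  by rewrite -mulr_sumr sqrtrM ?sqr_ge0// sqrtr_sqr ger0_norm.
have hh : sqhead z <= (Num.sqrt A + t * Num.sqrt B) ^+ 2.
  rewrite /sqhead; under eq_bigr do rewrite zE.
  by rewrite /B -tw; exact: sum_Minkowski.
have ht : sqtail z <= (Num.sqrt A2 + t * Num.sqrt B2) ^+ 2.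
  rewrite /sqtail; under eq_bigr do rewrite zE.
  by rewrite /B2 -tw; exact: sum_Minkowski.
have sA : Num.sqrt A <= 1.
  rewrite -[leRHS]sqrtr1 ler_sqrt//; apply: le_trans hA.
  by rewrite lerDl mulr_ge0// exprn_ge0// invr_ge0 ltW.
have sA2 : Num.sqrt A2 <= eps.
  rewrite -[leRHS](ger0_norm (ltW e0)) -sqrtr_sqr ler_sqrt ?sqr_ge0//.
  rewrite -[leRHS]mul1r -ler_pdivrMr ?exprn_gt0// -exprVn; apply: le_trans hA.
  by rewrite lerDr.
have sB : Num.sqrt B ^+ 2 + Num.sqrt B2 ^+ 2 <= 1 by rewrite !sqr_sqrtr.
move: (sqrtr_ge0 A) (sqrtr_ge0 A2) (sqrtr_ge0 B) (sqrtr_ge0 B2) sA sA2 sB hh ht.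
move: (Num.sqrt A) (Num.sqrt A2) (Num.sqrt B) (Num.sqrt B2) => x x2 y y2.
move=> x0 x20 y0 y20 x1 x2e yy hh ht.
have y21 : y2 <= 1 by nra.
have ht' : sqtail z <= (eps + t * y2) ^+ 2.
  have ty2 : 0 <= t * y2 by rewrite mulr_ge0.
  apply: le_trans ht _; rewrite ler_sqr ?nnegrE ?lerD2r//.
    exact: addr_ge0.
  by rewrite addr_ge0// ltW.
have key : (t * y) ^+ 2 <= (t + eps) ^+ 2 - sqtail z.
  rewrite lerBrDr; apply: le_trans (_ : (t * y) ^+ 2 + (eps + t * y2) ^+ 2 <= _).
    by rewrite lerD2l.
  have h1 : t ^+ 2 * (y ^+ 2 + y2 ^+ 2) <= t ^+ 2 by rewrite ler_piMr ?sqr_ge0.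
  have h2 : 0 <= t * eps * (1 - y2) by rewrite mulr_ge0 ?subr_ge0// mulr_ge0// ltW.
  lra.
split.
  by rewrite -subr_ge0; apply: le_trans key; exact: sqr_ge0.
apply: le_trans hh _; rewrite ler_sqr ?nnegrE ?addr_ge0 ?mulr_ge0 ?sqrtr_ge0//.
apply: lerD => //.
rewrite -[leLHS]ger0_norm ?mulr_ge0// -sqrtr_sqr ler_sqrt//.
by apply: le_trans key; exact: sqr_ge0.
Qed.

Lemma minkowski_poly_bounds n q (eps t : R) (M : {poly R}) :
  0 < eps -> 0 < t -> is_minkowski_poly (ellipsoid n q eps) M ->
  (disc_poly n q).[t] <= M.[t] <= (disc_poly n q).[t + eps].
Proof.
move=> e0 t0 [_ /(_ t (ltW t0)) hM].
have te0 : 0 <= t + eps by rewrite ltW// addr_gt0.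
rewrite -!lee_fin -hM -(volume_disc_parallel _ _ (ltW t0)).
rewrite -(volume_disc_parallel _ _ te0) /volume.
apply/andP; split; apply: (@tuple_measure_mono _ mR R leb (n + q)) => z /=.
  exact: disc_parallel_sub.
by apply: parallel_body_sub => //; exact: ltW.
Qed.

End sandwich.

(** * Polynomials with nonpositive real roots *)

Lemma cvgn_sum {R : realType} (I : Type) (s : seq I) (u : I -> nat -> R) (l : I -> R) :
  (forall i, (u i k @[k --> \oo] --> l i)%classic) ->
  (\sum_(i <- s) u i k @[k --> \oo] --> \sum_(i <- s) l i)%classic.
Proof.
move=> ul; elim: s => [|i s IH].
  by rewrite big_nil; under eq_fun do rewrite big_nil; exact: cvg_cst.
rewrite big_cons; under eq_fun do rewrite big_cons.
by apply: cvgD.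
Qed.

Section complex_real_poly.
Context {R : realType}.
Local Notation C := R[i].
Implicit Types (p : {poly R}) (z t : C) (rs : seq R).

(** The squared modulus as an element of R, so that limits are taken in R. *)
Definition sqmod z : R := complex.Re z ^+ 2 + complex.Im z ^+ 2.

Lemma sqmodM z t : sqmod (z * t) = sqmod z * sqmod t.
Proof. by case: z t => [a b] [c d]; rewrite /sqmod/=; ring. Qed.

Lemma sqmod_eq0 z : (sqmod z == 0) = (z == 0).
Proof.
case: z => a b; rewrite /sqmod/= paddr_eq0 ?sqr_ge0// !sqrf_eq0.
by rewrite eq_complex/=.
Qed.

Lemma sqmod_ge0 z : 0 <= sqmod z.
Proof. by rewrite addr_ge0 ?sqr_ge0. Qed.

Lemma sqmod_conj z : sqmod z^* = sqmod z.
Proof. by case: z => a b; rewrite /sqmod/= sqrrN. Qed.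

Lemma complex_poly_conj p z : (complex_poly p).[z^*] = (complex_poly p).[z]^*.
Proof.
rewrite -(horner_map (Num.conj : {rmorphism C -> C})); congr (_.[_]).
apply/polyP => i; rewrite !coef_map/=.
by apply/eqP; rewrite eq_complex/= oppr0 !eqxx.
Qed.

Lemma Re_complex_poly p n z : (size p <= n)%N ->
  complex.Re (complex_poly p).[z] = \sum_(j < n) p`_j * complex.Re (z ^+ j).
Proof.
move=> pn; rewrite (@horner_coef_wide _ n); last by rewrite size_map_poly.
rewrite raddf_sum; apply: eq_bigr => j _; rewrite coef_map/=.
by case: (z ^+ j) => a b /=; rewrite mul0r subr0.
Qed.

Lemma Im_complex_poly p n z : (size p <= n)%N ->
  complex.Im (complex_poly p).[z] = \sum_(j < n) p`_j * complex.Im (z ^+ j).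
Proof.
move=> pn; rewrite (@horner_coef_wide _ n); last by rewrite size_map_poly.
rewrite raddf_sum; apply: eq_bigr => j _; rewrite coef_map/=.
by case: (z ^+ j) => a b /=; rewrite mul0r addr0.
Qed.

Lemma complex_poly_eq0 p : (complex_poly p == 0) = (p == 0).
Proof. by rewrite map_poly_eq0. Qed.

(** The constant c may be 0: the zero polynomial belongs to the class, as the even
or the odd part of a polynomial may vanish. *)
Definition nonpos_rooted p : Prop :=
  exists c rs, all (fun r : R => r <= 0) rs /\ p = c *: \prod_(r <- rs) ('X - r%:P).

Lemma nonpos_rooted0 : nonpos_rooted 0.
Proof. by exists 0, [::]; rewrite scale0r. Qed.

Lemma nonpos_rootedP p :
  (forall z, root (complex_poly p) z -> complex.Im z = 0 /\ complex.Re z <= 0) ->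
  nonpos_rooted p.
Proof.
move=> hp; have [rs pE] := closed_field_poly_normal (complex_poly p).
have [p0|p0] := eqVneq p 0; first by rewrite p0; exact: nonpos_rooted0.
have rsp z : z \in rs -> complex.Im z = 0 /\ complex.Re z <= 0.
  move=> zrs; apply: hp; rewrite pE rootZ ?lead_coef_eq0 ?complex_poly_eq0//.
  by rewrite root_prod_XsubC.
exists (lead_coef p), (map (@complex.Re R) rs); split.
  by apply/allP => _ /mapP[z /rsp[_ h] ->].
apply: (map_poly_inj (real_complex R : {rmorphism R -> C})).
rewrite -/(complex_poly p) pE map_polyZ/= lead_coef_map; congr (_ *: _).
rewrite rmorph_prod big_map; apply: eq_big_seq => z /rsp[Im0 _].
rewrite rmorphB/= map_polyX map_polyC/=; congr (_ - _%:P).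
by move: Im0; case: z => a b /= ->.
Qed.

Lemma complex_prod_XsubC (c : R) rs z :
  (complex_poly (c *: \prod_(r <- rs) ('X - r%:P))).[z] =
  c%:C%C * \prod_(r <- rs) (z - r%:C%C).
Proof.
rewrite /complex_poly map_polyZ/= hornerZ rmorph_prod horner_prod; congr (_ * _).
by apply: eq_bigr => r _; rewrite rmorphB/= map_polyX map_polyC/= hornerXsubC.
Qed.

Lemma nonpos_rooted_root p z : nonpos_rooted p -> p != 0 ->
  root (complex_poly p) z -> complex.Im z = 0 /\ complex.Re z <= 0.
Proof.
move=> [c [rs [/allP hrs pE]]] p0; rewrite pE rootE complex_prod_XsubC mulf_eq0.
have c0 : c != 0 by apply: contraNneq p0 => c0; rewrite pE c0 scale0r.
rewrite fmorph_eq0 (negbTE c0)/= prodf_seq_eq0 => /hasP[r /hrs r0]/=.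
by rewrite subr_eq0 => /eqP ->.
Qed.

(** A substitute for real-rootedness which, being an inequality between continuous
functions of the coefficients, passes to limits. *)
Definition vertical_mono p : Prop := forall x y' y : R, y' ^+ 2 <= y ^+ 2 ->
  sqmod (complex_poly p).[(x +i* y')%C] <= sqmod (complex_poly p).[(x +i* y)%C].

Lemma nonpos_rooted_mono p : nonpos_rooted p -> vertical_mono p.
Proof.
move=> [c [rs [_ ->]]] x y' y yy; rewrite !complex_prod_XsubC !sqmodM.
apply: ler_wpM2l; first exact: sqmod_ge0.
elim: rs => [|r rs IH]; first by rewrite !big_nil.
rewrite !big_cons !sqmodM; apply: ler_pM; rewrite ?sqmod_ge0//.
by rewrite /sqmod/= !oppr0 !addr0 lerD2l.
Qed.

(** A nonreal root x + iy would force roots at x + iy' for all |y'| <= |y|, that is,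
infinitely many; nonnegative coefficients exclude positive roots. *)
Lemma vertical_mono_nonpos p : vertical_mono p -> p != 0 ->
  (forall j, 0 <= p`_j) -> nonpos_rooted p.
Proof.
move=> mp p0 pj; apply: nonpos_rootedP => -[x y] /= rz.
have P0 : complex_poly p != 0 by rewrite complex_poly_eq0.
(* The roots x + i y / (j+1), for j below the size of p, are too many. *)
have y0 : y = 0.
  apply/eqP/negPn/negP => y0.
  pose s := [seq (x +i* (y / j.+1%:R))%C | j <- iota 0 (size p)].
  suff : (size s < size (complex_poly p))%N.
    by rewrite size_map size_iota size_map_poly ltnn.
  apply: (max_poly_roots P0); last first.
    rewrite map_inj_uniq ?iota_uniq// => i j [] /(mulfI y0) /invr_inj /eqP.
    by rewrite eqr_nat => /eqP [].
  apply/allP => _ /mapP[j _ ->]; rewrite rootE -sqmod_eq0 eq_le sqmod_ge0 andbT.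
  move/eqP: rz => rz; rewrite -[leRHS](_ : sqmod (complex_poly p).[(x +i* y)%C] = 0).
    apply: mp; rewrite exprMn ler_piMr ?sqr_ge0// exprVn invf_le1 ?exprn_gt0//.
    by rewrite exprn_ege1// ler1n.
  by rewrite rz /sqmod/= expr0n addr0.
split => //; rewrite leNgt; apply/negP => x0.
move: rz; rewrite y0 => /eqP /(congr1 (@complex.Re R)) /=.
have -> : (x +i* 0)%C = real_complex R x by [].
rewrite horner_map/= horner_coef => /(psumr_eq0P) h.
suff : lead_coef p * x ^+ (size p).-1 = 0.
  by move/eqP; rewrite mulf_eq0 lead_coef_eq0 (negbTE p0) expf_eq0 (gt_eqF x0) andbF.
have sp : ((size p).-1 < size p)%N by rewrite prednK// size_poly_gt0.
apply: (h _ (Ordinal sp) isT) => i _.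
by rewrite mulr_ge0// exprn_ge0// ltW.
Qed.

Lemma vertical_mono_lim (p_ : nat -> {poly R}) p n :
  (forall k, size (p_ k) <= n)%N -> (size p <= n)%N ->
  (forall j, ((p_ k)`_j @[k --> \oo] --> p`_j)%classic) ->
  (forall k, vertical_mono (p_ k)) -> vertical_mono p.
Proof.
move=> spk sp cp mp x y' y yy.
have cv z : (sqmod (complex_poly (p_ k)).[z] @[k --> \oo] -->
             sqmod (complex_poly p).[z])%classic.
  rewrite /sqmod (Re_complex_poly _ sp) (Im_complex_poly _ sp).
  under eq_fun do rewrite (Re_complex_poly _ (spk _)) (Im_complex_poly _ (spk _)).
  apply: cvgD; rewrite expr2; under eq_fun do rewrite expr2.
    by apply: cvgM; apply: cvgn_sum => j; (apply: cvgM; [exact: cp|exact: cvg_cst]).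
  by apply: cvgM; apply: cvgn_sum => j; (apply: cvgM; [exact: cp|exact: cvg_cst]).
apply: (ler_cvg_to (cv _) (cv _)); apply: nearW => k; exact: mp.
Qed.

(** Multiplying p by X - r changes p'^2 - p p'' into
p^2 + (x - r)^2 (p'^2 - p p''). *)
Lemma Laguerre_ineq p x : nonpos_rooted p ->
  0 <= p^`().[x] ^+ 2 - p.[x] * p^`()^`().[x].
Proof.
move=> [c [rs [_ ->]]]; rewrite !derivZ !hornerZ.
set q := \prod_(r <- rs) _.
have -> : (c * q^`().[x]) ^+ 2 - c * q.[x] * (c * q^`()^`().[x]) =
  c ^+ 2 * (q^`().[x] ^+ 2 - q.[x] * q^`()^`().[x]) by ring.
rewrite mulr_ge0 ?sqr_ge0// {}/q.
elim: rs => [|r rs]; first by rewrite big_nil derivC deriv0 !horner0 mulr0 expr0n subrr.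
rewrite big_cons; set q := \prod_(r <- rs) _ => IH.
rewrite derivM derivXsubC mul1r derivD derivM derivXsubC mul1r !hornerD !hornerM !hornerXsubC.
have -> : (q.[x] + (x - r) * q^`().[x]) ^+ 2 -
    (x - r) * q.[x] * (q^`().[x] + (q^`().[x] + (x - r) * q^`()^`().[x])) =
  q.[x] ^+ 2 + (x - r) ^+ 2 * (q^`().[x] ^+ 2 - q.[x] * q^`()^`().[x]) by ring.
by apply: addr_ge0; [exact: sqr_ge0|apply: mulr_ge0 => //; exact: sqr_ge0].
Qed.

End complex_real_poly.

(** * Operations that produce nonpositive real roots *)

Section real_rooted_transfer.
Context {R : realType}.
Local Notation C := R[i].
Implicit Types (p : {poly R}) (z t : C).

(** A convex cone that contains 1 and the open upper half-plane, but no negative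
real; the logarithmic derivative z p'(z) / p(z) stays in it. *)
Definition right_cone z : bool :=
  (0 < complex.Im z) || (complex.Im z == 0) && (0 <= complex.Re z).

Lemma right_coneD z t : right_cone z -> right_cone t -> right_cone (z + t).
Proof.
case: z t => [a b] [c d]; rewrite /right_cone/=.
move=> /orP[b0|/andP[/eqP-> a0]] /orP[d0|/andP[/eqP-> c0]].
- by rewrite addr_gt0.
- by rewrite addr0 b0.
- by rewrite add0r d0.
- by rewrite addr0 eqxx addr_ge0// orbT.
Qed.

(** Half of the complement of the nonpositive reals; conjugation gives the other
half. *)
Definition upper z : bool :=
  (0 < complex.Im z) || (complex.Im z == 0) && (0 < complex.Re z).

Lemma upper_neq z (r : R) : upper z -> r <= 0 -> z - r%:C%C != 0.
Proof.
case: z => x y; rewrite /upper/= => h r0; rewrite eq_complex/= oppr0 addr0.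
by case/orP: h => [y0|/andP[/eqP-> x0]];
  rewrite ?(gt_eqF y0) ?andbF ?eqxx ?andbT// gt_eqF// subr_gt0 (le_lt_trans r0).
Qed.

Lemma upper_cone z (r : R) : upper z -> r <= 0 -> right_cone (z / (z - r%:C%C)).
Proof.
move=> uz r0; have := upper_neq uz r0; move: uz.
case: z => x y; rewrite /upper/right_cone/= oppr0 addr0 => h nz.
have D0 : 0 < (x - r) ^+ 2 + y ^+ 2.
  rewrite lt_neqAle addr_ge0 ?sqr_ge0// andbT eq_sym.
  rewrite paddr_eq0 ?sqr_ge0// !sqrf_eq0.
  by apply: contra nz; rewrite eq_complex/= oppr0 addr0.
set D := _ + _ in D0 *.
have -> : x * (- (y / D)) + y * ((x - r) / D) = - r * y / D by ring.
have -> : x * ((x - r) / D) - y * (- (y / D)) = (x * (x - r) + y ^+ 2) / D by ring.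
case/orP: h => [y0|/andP[/eqP y0 x0]].
  move: r0; rewrite le_eqVlt => /predU1P[r0|r0].
    rewrite r0 oppr0 !mul0r ltxx eqxx/= addr0 divr_ge0 ?(ltW D0)//.
    by rewrite -expr2 addr_ge0 ?sqr_ge0.
  by rewrite divr_gt0// mulr_gt0// oppr_gt0.
rewrite y0 mulr0 mul0r ltxx eqxx/= divr_ge0 ?(ltW D0)// expr0n/= addr0.
by rewrite mulr_ge0 ?subr_ge0 1?ltW// (le_lt_trans r0).
Qed.

(** z q'(z) / q(z) is the sum of the z / (z - r), each of which lies in the
cone. *)
Lemma log_deriv_cone (rs : seq R) z : upper z -> all (fun r => r <= 0) rs ->
  let q := complex_poly (\prod_(r <- rs) ('X - r%:P)) in
  q.[z] != 0 /\ exists2 g, right_cone g & z * q^`().[z] = g * q.[z].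
Proof.
move=> uz; elim: rs => [_|r rs IH /= /andP[r0 hrs]] /=.
  rewrite big_nil /complex_poly rmorph1 hornerC oner_neq0; split => //.
  exists 0; first by rewrite /right_cone/= ltxx eqxx lexx.
  by rewrite -[1]/(1%:P) derivC horner0 mulr0 mul0r.
have [qn0 [g cg gE]] := IH hrs.
rewrite big_cons.
set q := complex_poly _ in qn0 gE.
have -> : complex_poly (('X - r%:P) * \prod_(r <- rs) ('X - r%:P)) =
          ('X - (r%:C%C)%:P) * q.
  by rewrite /complex_poly rmorphM/= rmorphB/= map_polyX map_polyC.
have zr := upper_neq uz r0.
rewrite hornerM hornerXsubC mulf_neq0//; split => //.
exists (z / (z - r%:C%C) + g); first by rewrite right_coneD// upper_cone.
rewrite derivM derivXsubC mul1r hornerD hornerM hornerXsubC mulrDr.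
rewrite [z * (_ * q^`().[z])]mulrCA gE [RHS]mulrDl; congr (_ + _).
  by rewrite mulrA divfK.
by rewrite mulrCA.
Qed.

(** At a root z one would have 2 z p'(z) / p(z) = -a, but -a is not in the cone.
This is the Gauss-Lucas theorem for t^a p(t^2), written in u = t^2. *)
Lemma nonpos_rooted_descent (a : R) p : 0 < a -> nonpos_rooted p ->
  nonpos_rooted (a *: p + 2 *: ('X * p^`())).
Proof.
move=> a0 [c [rs [hrs pE]]].
have [p0|pn0] := eqVneq p 0.
  by rewrite p0 deriv0 mulr0 !scaler0 addr0; exact: nonpos_rooted0.
have c0 : c != 0 by apply: contraNneq pn0 => c0; rewrite pE c0 scale0r.
have up z : upper z -> ~~ root (complex_poly (a *: p + 2 *: ('X * p^`()))) z.
  move=> uz; have [qn0 [g cg gE]] := log_deriv_cone uz hrs.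
  move: qn0 gE; set q := complex_poly _ => qn0 gE.
  have -> : complex_poly (a *: p + 2 *: ('X * p^`())) =
      c%:C%C *: (a%:C%C *: q + 2 *: ('X * q^`())).
    rewrite /complex_poly rmorphD/= !map_polyZ/= rmorphM/= map_polyX -deriv_map.
    rewrite pE map_polyZ/= -/(complex_poly _) -/q derivZ.
    rewrite -scalerAr !scalerDr !scalerA (mulrC a%:C%C); congr (_ + _ *: _).
    by rewrite mulrC rmorph_nat.
  rewrite rootZ ?fmorph_eq0// rootE hornerD !hornerZ hornerM hornerX gE.
  rewrite mulrA -mulrDl mulf_eq0 negb_or qn0 andbT.
  move: cg; rewrite eq_complex; case: g {gE} => x y /=; rewrite /right_cone/=.
  rewrite !addr0 !mul0r subr0 !addr0 add0r.
  case/orP => [y0|/andP[_ x0]]; rewrite negb_and.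
    by rewrite (gt_eqF (mulr_gt0 _ y0)) ?orbT// addr_gt0.
  rewrite (gt_eqF (ltr_pwDl a0 _))//; rewrite mulr_ge0// addr_ge0//.
apply: nonpos_rootedP => z rz.
have Im0 : complex.Im z = 0.
  apply/eqP/negPn; rewrite neq_lt; apply/negP => /orP[y0|y0].
    have : root (complex_poly (a *: p + 2 *: ('X * p^`()))) z^*.
      rewrite rootE complex_poly_conj; move: rz; rewrite rootE => /eqP ->.
      by rewrite conjC0.
    apply/negP/up; rewrite /upper; case: z y0 {rz} => x y /= y0.
    by rewrite oppr_gt0 y0.
  by move: rz; apply/negP/up; rewrite /upper y0.
split=> //; rewrite leNgt; apply/negP => x0.
by move: rz; apply/negP/up; rewrite /upper Im0 eqxx x0 orbT.
Qed.

Lemma complex_sqrt_right z : exists2 t, t ^+ 2 = z & 0 <= complex.Re t.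
Proof.
have [h|h] := leP 0 (complex.Re (sqrtC z)); first by exists (sqrtC z); rewrite ?sqrtCK.
exists (- sqrtC z); first by rewrite sqrrN sqrtCK.
by rewrite raddfN/= oppr_ge0 ltW.
Qed.

Lemma imag_sqr t z : t ^+ 2 = z -> complex.Re t = 0 ->
  complex.Im z = 0 /\ complex.Re z <= 0.
Proof.
case: t => a b /= <- ->; rewrite expr2/= !mul0r !mulr0 addr0 sub0r oppr_le0.
by rewrite -expr2 sqr_ge0.
Qed.

Lemma even_imag_rooted p :
  (forall t, root (complex_poly (p \Po 'X^2)) t -> complex.Re t = 0) ->
  nonpos_rooted p.
Proof.
move=> hp; apply: nonpos_rootedP => z rz.
have [t tz _] := complex_sqrt_right z.
apply: (imag_sqr tz); apply: hp.
by rewrite /complex_poly map_comp_poly map_polyXn rootE horner_comp hornerXn tz.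
Qed.

Lemma prod_sqmod (rs : seq C) (f : C -> C) :
  sqmod (\prod_(r <- rs) f r) = \prod_(r <- rs) sqmod (f r).
Proof.
elim: rs => [|r rs IH]; first by rewrite !big_nil /sqmod/= expr1n expr0n addr0.
by rewrite !big_cons sqmodM IH.
Qed.

Lemma complex_poly_parts p t :
  (complex_poly p).[t] = (complex_poly (even_poly p)).[t ^+ 2] +
    t * (complex_poly (odd_poly p)).[t ^+ 2].
Proof.
rewrite -{1}(poly_even_odd p) /complex_poly rmorphD/= rmorphM/=.
rewrite !map_comp_poly map_polyXn map_polyX hornerD hornerM !horner_comp.
by rewrite !hornerXn hornerX mulrC.
Qed.

(** If all roots have nonpositive real part then |p(- conj t0)| <= |p(t0)| factor by
factor, with equality only if all roots are imaginary.  Since p is real,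
|p(-t0)| = |p(- conj t0)|, so the hypothesis on t0 forces equality; then p is
even or odd, and the sign is the one observed at t0. *)
Lemma stable_reflect p t0 (s : C) :
  (forall z, root (complex_poly p) z -> complex.Re z <= 0) ->
  0 < complex.Re t0 -> s ^+ 2 = 1 ->
  (complex_poly p).[- t0] = s * (complex_poly p).[t0] ->
  forall t, (complex_poly p).[- t] = s * (complex_poly p).[t].
Proof.
move=> hp t00 s1 hs.
have [rs pE] := closed_field_poly_normal (complex_poly p).
have [p0|p0] := eqVneq p 0.
  by move=> t; rewrite p0 /complex_poly rmorph0 !horner0 mulr0.
have lc0 : lead_coef (complex_poly p) != 0 by rewrite lead_coef_eq0 complex_poly_eq0.
have rsp z : z \in rs -> complex.Re z <= 0.
  by move=> zrs; apply: hp; rewrite pE rootZ ?root_prod_XsubC.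
have PE t : (complex_poly p).[t] = lead_coef (complex_poly p) * \prod_(z <- rs) (t - z).
  rewrite {1}pE hornerZ horner_prod; congr (_ * _).
  by apply: eq_bigr => z _; rewrite hornerXsubC.
have pt0 : (complex_poly p).[t0] != 0.
  by apply/negP => /hp; rewrite leNgt t00.
have ssq : sqmod s = 1.
  have := sqmodM s s; rewrite -expr2 s1 [sqmod 1]/sqmod/= expr1n expr0n addr0.
  move=> h; have : (sqmod s - 1) * (sqmod s + 1) = 0.
    by rewrite -subr_sqr expr1n expr2 -h subrr.
  move/eqP; rewrite mulf_eq0 subr_eq0 => /orP[/eqP//|].
  by rewrite gt_eqF// ltr_wpDl ?sqmod_ge0.
have ler z : z \in rs -> sqmod (- t0^* - z) <= sqmod (t0 - z) ?= iff (complex.Re z == 0).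
  move=> /rsp; case: z (t0) t00 => x y [a b] /= a0 x0; rewrite /sqmod/=.
  have E : (a - x) ^+ 2 + (b - y) ^+ 2 =
      (- a - x) ^+ 2 + (- - b - y) ^+ 2 + 4 * a * (- x) by ring.
  rewrite E; split; first by rewrite lerDl !mulr_ge0 ?oppr_ge0// ltW.
  rewrite -subr_eq0 opprD addrA subrr sub0r oppr_eq0 !mulf_eq0 oppr_eq0.
  by rewrite (gt_eqF a0) pnatr_eq0.
have imag z : z \in rs -> complex.Re z = 0.
  have : \prod_(z <- rs) sqmod (- t0^* - z) = \prod_(z <- rs) sqmod (t0 - z).
    have : sqmod (complex_poly p).[- t0^*] = sqmod (complex_poly p).[t0].
      rewrite -rmorphN complex_poly_conj sqmod_conj hs sqmodM ssq mul1r //.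
    rewrite !PE !sqmodM !prod_sqmod => /mulfI; apply.
    by rewrite sqmod_eq0.
  have pos w : w \in rs -> 0 < sqmod (t0 - w).
    move=> wrs; rewrite lt_neqAle sqmod_ge0 andbT eq_sym sqmod_eq0 subr_eq0.
    by apply/negP => /eqP tw; move: (rsp _ wrs); rewrite -tw leNgt t00.
  elim: {pE PE rsp} rs ler pos => [//|w rs IH] ler pos.
  rewrite !big_cons => e.
  have lw := ler w (mem_head _ _).
  have lerrs v : v \in rs -> sqmod (- t0^* - v) <= sqmod (t0 - v) ?= iff (complex.Re v == 0).
    by move=> vrs; apply: ler; rewrite inE vrs orbT.
  have posrs v : v \in rs -> 0 < sqmod (t0 - v).
    by move=> vrs; apply: pos; rewrite inE vrs orbT.
  have Q0 : 0 < \prod_(v <- rs) sqmod (t0 - v).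
    by rewrite big_seq; apply: prodr_gt0 => v; exact: posrs.
  have le2 : \prod_(v <- rs) sqmod (- t0^* - v) <= \prod_(v <- rs) sqmod (t0 - v).
    rewrite big_seq [leRHS]big_seq; apply: ler_prod => v vrs.
    by rewrite sqmod_ge0 (lerrs v vrs).
  have w1 : sqmod (- t0^* - w) = sqmod (t0 - w).
    apply/eqP; rewrite eq_le lw/= leNgt; apply/negP => lt1.
    have : sqmod (- t0^* - w) * \prod_(v <- rs) sqmod (- t0^* - v) <
           sqmod (t0 - w) * \prod_(v <- rs) sqmod (t0 - v).
      apply: le_lt_trans (_ : sqmod (- t0^* - w) * \prod_(v <- rs) sqmod (t0 - v) < _).
        by rewrite ler_wpM2l ?sqmod_ge0.
      by rewrite ltr_pM2r.
    by rewrite e ltxx.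
  rewrite inE => /predU1P[->|]; first by apply/eqP; rewrite -lw w1.
  apply: IH => //; apply: (mulfI (lt0r_neq0 (pos w (mem_head _ _)))).
  by rewrite -{1}w1 e.
have flip t : (complex_poly p).[- t] = (-1) ^+ size rs * (complex_poly p).[t].
  rewrite -[in RHS](conjCK t) complex_poly_conj PE PE rmorphM rmorph_prod/=.
  have -> : (lead_coef (complex_poly p))^* = lead_coef (complex_poly p).
    rewrite lead_coef_map; apply/eqP.
    by rewrite eq_complex/= oppr0 !eqxx.
  rewrite mulrCA; congr (_ * _).
  elim: rs imag {pE PE rsp ler} => [|w rs IH] imag; first by rewrite !big_nil mulr1.
  rewrite !big_cons IH; last by move=> v vrs; apply: imag; rewrite inE vrs orbT.
  rewrite /= exprS mulrACA; congr (_ * _).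
  have := imag w (mem_head _ _); case: w {IH imag} => x y /= ->; case: t => a b.
  by apply/eqP; rewrite eq_complex/=; apply/andP; split; apply/eqP; ring.
move=> t; rewrite flip; congr (_ * _).
by apply: (mulIf pt0); rewrite -flip hs.
Qed.

Lemma poly_root_all p : (forall z, z != 0 -> root (complex_poly p) z) -> p = 0.
Proof.
move=> h; apply/eqP; rewrite -complex_poly_eq0; apply/negPn/negP => P0.
pose s := [seq (j.+1%:R : C) | j <- iota 0 (size (complex_poly p))].
suff : (size s < size (complex_poly p))%N by rewrite size_map size_iota ltnn.
apply: (max_poly_roots P0).
  by apply/allP => _ /mapP[j _ ->]; apply: h; rewrite pnatr_eq0.
by rewrite map_inj_uniq ?iota_uniq// => i j /eqP; rewrite eqr_nat => /eqP[].
Qed.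

(** A root z of the even part which is not a nonpositive real is t^2 with Re t > 0,
and p(-t) = -p(t).  By [stable_reflect] p is then odd, so the even part is
0. *)
Lemma stable_even_part p :
  (forall z, root (complex_poly p) z -> complex.Re z <= 0) ->
  nonpos_rooted (even_poly p).
Proof.
move=> hp; have [e0|e0] := eqVneq (even_poly p) 0.
  by rewrite e0; exact: nonpos_rooted0.
apply: nonpos_rootedP => z /eqP rz; have [t tz] := complex_sqrt_right z.
rewrite le_eqVlt => /predU1P[t0|t0]; first exact: (imag_sqr tz).
case/eqP: e0; apply: poly_root_all => z' _.
have hr : forall t, (complex_poly p).[- t] = -1 * (complex_poly p).[t].
  apply: (stable_reflect hp t0); first by rewrite sqrrN expr1n.
  by rewrite !(complex_poly_parts p) sqrrN tz rz !add0r mulN1r mulNr.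
have [t' tz' _] := complex_sqrt_right z'.
have := hr t'; rewrite !(complex_poly_parts p) sqrrN tz' mulN1r opprD mulNr.
move/addIr/eqP; rewrite -subr_eq0 opprK -mulr2n -mulr_natl mulf_eq0.
by rewrite pnatr_eq0.
Qed.

(** As for the even part, with p(-t) = p(t). *)
Lemma stable_odd_part p :
  (forall z, root (complex_poly p) z -> complex.Re z <= 0) ->
  nonpos_rooted (odd_poly p).
Proof.
move=> hp; have [e0|e0] := eqVneq (odd_poly p) 0.
  by rewrite e0; exact: nonpos_rooted0.
apply: nonpos_rootedP => z /eqP rz; have [t tz] := complex_sqrt_right z.
rewrite le_eqVlt => /predU1P[t0|t0]; first exact: (imag_sqr tz).
case/eqP: e0; apply: poly_root_all => z' z'0.
have hr : forall t, (complex_poly p).[- t] = 1 * (complex_poly p).[t].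
  apply: (stable_reflect hp t0); first by rewrite expr1n.
  by rewrite !(complex_poly_parts p) sqrrN tz rz !mulr0 mul1r.
have [t' tz' _] := complex_sqrt_right z'.
have := hr t'; rewrite !(complex_poly_parts p) sqrrN tz' mul1r mulNr.
move/addrI/eqP; rewrite -subr_eq0 -opprD oppr_eq0 -mulr2n -mulr_natl !mulf_eq0.
rewrite pnatr_eq0/= => /orP[/eqP t'0|//].
by move: z'0; rewrite -tz' t'0 expr0n eqxx.
Qed.

End real_rooted_transfer.

(** * The limit polynomials and the descent in the codimension *)

Section disc_even_poly.
Context {R : realType}.

(** Up to normalization the Beta value B(j+1, Q/2), which is also the ratio
kappa_(Q+2j) / kappa_(2j). *)
Definition beta_ratio Q j : R := \prod_(i < j) ((2 * i.+1)%:R / (2 * i.+1 + Q)%:R).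

(** The part of the volume polynomial of the neighbourhoods of a flat n-disc in
codimension Q that consists of t^(Q+2j), with t^Q removed and t^2 replaced by
the variable. *)
Definition disc_even n Q : {poly R} :=
  \poly_(j < n./2.+1) ('C(n, 2 * j)%:R * beta_ratio Q j).

Lemma beta_ratioS Q j : beta_ratio Q j.+1 =
  beta_ratio Q j * ((2 * j.+1)%:R / (2 * j.+1 + Q)%:R).
Proof. by rewrite /beta_ratio big_ord_recr. Qed.

Lemma beta_ratio_gt0 Q j : 0 < beta_ratio Q j.
Proof. by apply: prodr_gt0 => i _; rewrite divr_gt0 ?ltr0n// addn_gt0. Qed.

Lemma coef_disc_even n Q j : (disc_even n Q)`_j = 'C(n, 2 * j)%:R * beta_ratio Q j.
Proof.
rewrite coef_poly; case: ifPn => //; rewrite -leqNgt => nj.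
by rewrite bin_small ?mul0r//; lia.
Qed.

Lemma disc_even_neq0 n Q : disc_even n Q != 0.
Proof.
apply/eqP => /(congr1 (fun p : {poly R} => p`_0)).
rewrite coef_disc_even muln0 bin0 coef0 /beta_ratio big_ord0 mulr1 => /eqP.
by rewrite oner_eq0.
Qed.

Lemma nonpos_rootedZ (a : R) p : nonpos_rooted p -> nonpos_rooted (a *: p).
Proof. by move=> [c [rs [h ->]]]; exists (a * c), rs; rewrite scalerA. Qed.

Lemma beta_ratio_shift Q j :
  (Q.+2 + 2 * j)%:R * beta_ratio Q.+2 j = Q.+2%:R * beta_ratio Q j.
Proof.
elim: j => [|j IH]; first by rewrite /beta_ratio !big_ord0 muln0 addn0.
rewrite !beta_ratioS.
have -> : (Q.+2 + 2 * j.+1 = 2 * j.+1 + Q.+2)%N by lia.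
have -> : (2 * j.+1 + Q = Q.+2 + 2 * j)%N by lia.
have n0 : (2 * j.+1 + Q.+2)%:R != 0 :> R by rewrite pnatr_eq0.
have n1 : (Q.+2 + 2 * j)%:R != 0 :> R by rewrite pnatr_eq0.
move: n0 n1 IH; move: (beta_ratio Q.+2 j) (beta_ratio Q j) => b' b.
move: (_ + _)%:R (_ + _)%:R (2 * _)%:R Q.+2%:R => Y X W q Y0 X0 IH.
transitivity (b' * W); first by field.
by rewrite mulrA -IH; field.
Qed.

(** The identity (t^(Q+2) A_(n,Q+2)(t^2))' = (Q+2) t^(Q+1) A_(n,Q)(t^2) between
the volume polynomials in two codimensions. *)
Lemma nonpos_rooted_disc_evenS2 n Q :
  nonpos_rooted (disc_even n Q.+2) -> nonpos_rooted (disc_even n Q).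
Proof.
move=> /(nonpos_rooted_descent (a := Q.+2%:R) (ltr0Sn _ _)) h.
suff -> : disc_even n Q = Q.+2%:R^-1 *:
    (Q.+2%:R *: disc_even n Q.+2 + 2 *: ('X * (disc_even n Q.+2)^`())).
  exact: nonpos_rootedZ.
apply/polyP => j; rewrite coefZ coefD !coefZ coefXM coef_deriv.
have -> : (if j == 0%N then 0 else (disc_even n Q.+2)`_j.-1.+1 *+ j.-1.+1) =
    (disc_even n Q.+2)`_j * j%:R by case: j => [|j] /=; rewrite ?mulr0 ?mulr_natr.
rewrite !coef_disc_even; apply: (mulfI (_ : Q.+2%:R != 0)); first by rewrite pnatr_eq0.
rewrite [RHS]mulrA mulfV ?pnatr_eq0// mul1r mulrCA -beta_ratio_shift natrD natrM; ring.
Qed.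

Lemma disc_even_base n Q : (5 <= Q)%N -> nonpos_rooted (disc_even n Q) ->
  nonpos_rooted (disc_even n 5) \/ nonpos_rooted (disc_even n 6).
Proof.
elim/ltn_ind: Q => Q IH Q5 h.
have [Q5'|Q5'] := eqVneq Q 5%N; first by left; rewrite -Q5'.
have [Q6|Q6] := eqVneq Q 6%N; first by right; rewrite -Q6.
case: Q => [|[|Q]] // in IH Q5 Q5' Q6 h *.
by apply: (IH Q) => //; [lia|exact: nonpos_rooted_disc_evenS2].
Qed.

End disc_even_poly.

(** * Failure of the Laguerre inequality for large n *)

Section numeric.
Context {R : realType}.
Variables (Q m : nat).

Definition series_den i : nat := ((2 * i.+1 + Q) * (2 * i).+1)%N.

(** The coefficients of the entire function to which A_(n,Q)(u / n^2) tends: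
beta_(Q,j) / (2j)!. *)
Definition series_coef j : R := \prod_(i < j) (series_den i)%:R^-1.

Definition ffact_ratio k n : R := (n ^_ k)%:R / n%:R ^+ k.

Lemma series_coefS j : series_coef j.+1 = series_coef j / (series_den j)%:R.
Proof. by rewrite /series_coef big_ord_recr. Qed.

Lemma series_den_gt0 i : 0 < (series_den i)%:R :> R.
Proof. by rewrite ltr0n muln_gt0 addn_gt0. Qed.

Lemma series_coef_gt0 j : 0 < series_coef j.
Proof. by apply: prodr_gt0 => i _; rewrite invr_gt0 series_den_gt0. Qed.

Lemma beta_ratio_fact j : beta_ratio Q j = series_coef j * ((2 * j)`!)%:R.
Proof.
elim: j => [|j IH]; first by rewrite /beta_ratio /series_coef !big_ord0 mulr1.
rewrite beta_ratioS series_coefS IH /series_den.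
have -> : (2 * j.+1 = (2 * j).+2)%N by lia.
rewrite !factS !natrM.
have h1 : ((2 * j).+2 + Q)%:R != 0 :> R by rewrite pnatr_eq0.
have h2 : (2 * j).+1%:R != 0 :> R by rewrite pnatr_eq0.
move: (((2 * j).+2 + Q)%:R) ((2 * j).+1%:R) h1 h2 => a b a0 b0.
by field; rewrite a0 b0.
Qed.

Lemma disc_even_term n j : (0 < n)%N ->
  (disc_even n Q)`_j * (- m%:R / n%:R ^+ 2) ^+ j =
  series_coef j * ffact_ratio (2 * j) n * (- m%:R) ^+ j.
Proof.
move=> n0; have n0' : n%:R != 0 :> R by rewrite pnatr_eq0 -lt0n.
rewrite coef_disc_even beta_ratio_fact /ffact_ratio -bin_ffact natrM.
rewrite exprMn exprVn -exprM; field.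
by rewrite expf_neq0.
Qed.

Lemma ffact_ratioS k n : ffact_ratio k.+1 n = ffact_ratio k n * ((n - k)%:R / n%:R).
Proof. by rewrite /ffact_ratio ffactnSr natrM exprS invfM; ring. Qed.

Lemma ffact_ratio_bound k n : 0 <= ffact_ratio k n <= 1.
Proof.
elim: k => [|k /andP[h0 h1]]; first by rewrite /ffact_ratio ffactn0 expr0 divr1 ler01 lexx.
have q0 : 0 <= (n - k)%:R / n%:R :> R by rewrite divr_ge0.
have q1 : (n - k)%:R / n%:R <= 1 :> R.
  case: n => [|n] in h0 h1 q0 *; first by rewrite invr0 mulr0.
  by rewrite ler_pdivrMr ?ltr0n// mul1r ler_nat leq_subr.
by rewrite ffact_ratioS mulr_ge0//= mulr_ile1.
Qed.

Lemma ffact_ratio_cvg k : (ffact_ratio k n @[n --> \oo] --> (1 : R))%classic.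
Proof.
elim: k => [|k IH].
  by rewrite /ffact_ratio; under eq_fun do rewrite ffactn0 expr0 divr1; exact: cvg_cst.
under eq_fun do rewrite ffact_ratioS.
suff h : ((n - k)%:R / n%:R : R) @[n --> \oo] --> (1 - k%:R * 0 : R).
  have := cvgM IH h; rewrite mulr0 subr0 mulr1. exact.
apply: (@cvg_trans _ ((1 - k%:R * n%:R^-1 : R) @[n --> \oo])).
  apply: near_eq_cvg; near=> n.
  have kn : (k < n)%N by near: n; exact: nbhs_infty_gt.
  have n0 : n%:R != 0 :> R by rewrite pnatr_eq0 -lt0n (leq_ltn_trans _ kn).
  by rewrite natrB ?(ltnW kn)// mulrBl divff.
apply: cvgB; first exact: cvg_cst.
apply: cvgM; first exact: cvg_cst.
apply/(@gtr0_cvgV0 _ _ _ _ (fun n : nat => n%:R : R)); last exact: cvgr_idn.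
by near=> n; rewrite ltr0n; near: n; exact: nbhs_infty_gt.
Unshelve. all: by end_near. Qed.

(** Partial sums at u = -m.  The weights w are 1, j and j(j-1), which give f, u f'
and u^2 f''. *)
Definition series_part (w : nat -> nat) J : R :=
  \sum_(j < J) (w j)%:R * series_coef j * (- m%:R) ^+ j.

Definition series_term (w : nat -> nat) n j : R :=
  (w j)%:R * series_coef j * ffact_ratio (2 * j) n * (- m%:R) ^+ j.

Lemma series_term_cvg w J :
  (\sum_(j < J) series_term w n j @[n --> \oo] --> series_part w J)%classic.
Proof.
apply: cvgn_sum => j.
have := cvgM (cvgM (@cvg_cst _ ((w j)%:R * series_coef j : R) nat \oo _)
  (ffact_ratio_cvg (2 * j))) (@cvg_cst _ ((- m%:R) ^+ j : R) nat \oo _).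
rewrite mulr1; exact.
Qed.

(** The factor j^2 dominates the three weights for j > 0. *)
Definition majorant j : R := (j ^ 2)%:R * series_coef j * m%:R ^+ j.

Lemma majorant_ge0 j : 0 <= majorant j.
Proof.
by rewrite /majorant -mulrA !mulr_ge0 ?exprn_ge0// ltW// series_coef_gt0.
Qed.

(** The ratio of consecutive coefficients is 1 / ((2j+2+Q)(2j+1)), so the terms at
least halve once j > 2 and j^2 >= m. *)
Lemma majorant_half j : (2 < j)%N -> (m <= j ^ 2)%N ->
  majorant j.+1 <= 2^-1 * majorant j.
Proof.
move=> j2 mj; rewrite /majorant series_coefS exprS.
have d0 := series_den_gt0 j.
suff : (j.+1 ^ 2)%:R * m%:R / (series_den j)%:R <= 2^-1 * (j ^ 2)%:R :> R.
  move=> h; have -> : (j.+1 ^ 2)%:R * (series_coef j / (series_den j)%:R) * (m%:R * m%:R ^+ j) =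
    ((j.+1 ^ 2)%:R * m%:R / (series_den j)%:R) * (series_coef j * m%:R ^+ j) :> R by ring.
  rewrite -[X in _ <= _ * X]mulrA [leRHS]mulrA; apply: ler_wpM2r => //.
  by rewrite mulr_ge0 ?exprn_ge0// ltW// series_coef_gt0.
rewrite ler_pdivrMr// -mulrA -ler_pdivrMl ?invr_gt0// invrK -!natrM ler_nat.
rewrite /series_den.
apply: (@leq_trans (2 * (2 * j ^ 2 * j ^ 2))%N); last by nia.
by rewrite leq_mul2l /=; apply: leq_mul => //; nia.
Qed.

Lemma majorant_sum J k : (2 < J)%N -> (m <= J ^ 2)%N ->
  \sum_(J <= j < J + k) majorant j <= 2 * majorant J.
Proof.
move=> J2 mJ.
have step i : majorant (J + i) <= 2^-1 ^+ i * majorant J.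
  elim: i => [|i IH]; first by rewrite addn0 expr0 mul1r.
  rewrite addnS exprS -mulrA; apply: (le_trans (majorant_half _ _)).
  - by rewrite ltn_addr.
  - by apply: leq_trans mJ _; rewrite leq_exp2r// leq_addr.
  - by rewrite ler_wpM2l.
have : \sum_(J <= j < J + k) majorant j <= (2 - 2 * 2^-1 ^+ k) * majorant J.
  elim: k => [|k IH]; first by rewrite addn0 big_geq// expr0 mulr1 subrr mul0r.
  rewrite addnS big_nat_recr ?leq_addr//=; apply: le_trans (lerD IH (step k)) _.
  by rewrite -mulrDl ler_wpM2r ?majorant_ge0// exprS; lra.
move=> h; apply: le_trans h _; rewrite ler_wpM2r ?majorant_ge0//.
by rewrite lerBlDr lerDl mulr_ge0 ?exprn_ge0.
Qed.

Lemma series_term_tail w n J k : (forall j, (0 < j)%N -> (w j <= j ^ 2)%N) ->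
  (2 < J)%N -> (m <= J ^ 2)%N ->
  `| \sum_(J <= j < J + k) series_term w n j | <= 2 * majorant J.
Proof.
move=> wj J2 mJ; apply: le_trans (majorant_sum k J2 mJ).
apply: le_trans (ler_norm_sum _ _ _) _.
rewrite big_nat_cond [leRHS]big_nat_cond; apply: ler_sum => j /andP[/andP[Jj _] _].
have /andP[f0 f1] := ffact_ratio_bound (2 * j) n.
rewrite /series_term /majorant; move: (ffact_ratio _ _) f0 f1 => f f0 f1.
rewrite normrM normrX normrN normr_nat normrM (ger0_norm f0) ger0_norm; last first.
  by rewrite mulr_ge0// ltW// series_coef_gt0. apply: ler_wpM2r; first exact: exprn_ge0.
rewrite -[leRHS]mulr1; apply: ler_pM => //.
  by rewrite mulr_ge0// ltW// series_coef_gt0.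
rewrite ler_wpM2r ?(ltW (series_coef_gt0 _))// ler_nat wj//.
by apply: leq_trans Jj; apply: leq_trans J2.
Qed.

(** The Euler operator x d/dx multiplies the coefficient of x^j by j. *)
Lemma deriv_euler (p : {poly R}) x K : (size p <= K)%N ->
  [/\ p.[x] = \sum_(j < K) p`_j * x ^+ j,
      x * p^`().[x] = \sum_(j < K) j%:R * (p`_j * x ^+ j) &
      x ^+ 2 * p^`()^`().[x] = \sum_(j < K) (j * j.-1)%:R * (p`_j * x ^+ j)].
Proof.
move=> pK; have theta (r : {poly R}) : (size r <= K)%N ->
  (size ('X * r^`())%R <= K)%N /\ forall j, ('X * r^`())`_j = j%:R * r`_j.
  move=> rK; have c j : ('X * r^`())`_j = j%:R * r`_j.
    by rewrite coefXM coef_deriv; case: j => [|j]/=; rewrite ?mul0r// mulr_natl.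
  split=> //; apply/leq_sizeP => j Kj; rewrite c nth_default ?mulr0//.
  exact: leq_trans Kj.
have [s1 c1] := theta _ pK; have [s2 c2] := theta _ s1.
have e1 : x * p^`().[x] = \sum_(j < K) j%:R * (p`_j * x ^+ j).
  rewrite -[X in X * _](hornerX x) -hornerM (horner_coef_wide _ s1).
  by apply: eq_bigr => j _; rewrite c1 mulrA.
split => //; first exact: horner_coef_wide.
have : x * ('X * p^`())^`().[x] = \sum_(j < K) j%:R ^+ 2 * (p`_j * x ^+ j).
  rewrite -[X in X * _](hornerX x) -hornerM (horner_coef_wide _ s2).
  by apply: eq_bigr => j _; rewrite c2 c1 !mulrA expr2.
rewrite derivM derivX mul1r hornerD hornerM hornerX mulrDr mulrA -expr2 e1.
move=> /eqP; rewrite eq_sym addrC -subr_eq => /eqP <-; rewrite -sumrB.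
apply: eq_bigr => j _; rewrite -mulrBl; congr (_ * _).
by case: (j : nat) => [|i]/=; rewrite ?mul0n ?expr0n ?subrr// natrM -natr1; ring.
Qed.

(** A violation of the Laguerre inequality at -m / n^2, multiplied by the square
of this point.  The bounds s0, s1, s2 concern the three partial sums and d
their tails; the partial sums converge as n grows, and the tails are bounded
uniformly in n. *)
Lemma disc_even_not_rooted J (s0 s1 s2 d : R) :
  (2 < J)%N -> (m <= J ^ 2)%N -> (0 < m)%N ->
  2 * majorant J <= d ->
  series_part (fun=> 1%N) J < - s0 -> `| series_part id J | < s1 ->
  series_part (fun j => (j * j.-1)%N) J < - s2 ->
  d < s0 -> d < s2 -> (s1 + d) ^+ 2 < (s0 - d) * (s2 - d) ->
  exists N, forall n, (0 < n)%N -> (N <= n)%N -> ~ nonpos_rooted (disc_even n Q : {poly R}).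
Proof.
move=> J2 mJ m0 hd h0 h1 h2 ds0 ds2 hs.
pose w0 (j : nat) := 1%N; pose w2 (j : nat) := (j * j.-1)%N.
(* Strict bounds for the limits of the partial sums hold for large n. *)
have : (\forall n \near \oo, [/\ \sum_(j < J) series_term w0 n j < - s0,
    `| \sum_(j < J) series_term id n j | < s1 & \sum_(j < J) series_term w2 n j < - s2])%classic.
  have c0 := @series_term_cvg w0 J; have c1 := @series_term_cvg id J.
  have c2 := @series_term_cvg w2 J.
  near=> n; split; near: n.
  - exact: (cvgr_lt _ c0).
  - exact: (cvgr_lt _ (cvg_norm c1)).
  - exact: (cvgr_lt _ c2).
move=> [N _ hN]; exists N => n n0 Nn hyp.
have [{}h0 {}h1 {}h2] := hN n Nn.
pose x : R := - m%:R / n%:R ^+ 2.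
have x0 : x != 0.
  by rewrite mulf_neq0 ?oppr_eq0 ?pnatr_eq0 -?lt0n// invr_eq0 expf_neq0// pnatr_eq0 -lt0n.
pose K := (J + n./2.+1)%N.
have sK : (size (disc_even n Q : {poly R}) <= K)%N.
  by apply: leq_trans (size_poly _ _) _; exact: leq_addl.
have [e0 e1 e2] := deriv_euler x sK.
have split_sum (w : nat -> nat) : \sum_(j < K) (w j)%:R * ((disc_even n Q)`_j * x ^+ j) =
    \sum_(j < J) series_term w n j + \sum_(J <= j < K) series_term w n j.
  rewrite -(big_mkord predT (fun j => (w j)%:R * ((disc_even n Q)`_j * x ^+ j))).
  rewrite (@big_cat_nat _ _ _ J)//=; last exact: leq_addr.
  rewrite big_mkord; congr (_ + _); apply: eq_bigr => j _;
    by rewrite disc_even_term// /series_term !mulrA.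
have t0 := @series_term_tail w0 n J (n./2.+1) _ J2 mJ.
have t1 := @series_term_tail id n J (n./2.+1) _ J2 mJ.
have t2 := @series_term_tail w2 n J (n./2.+1) _ J2 mJ.
have {}t0 : `|\sum_(J <= j < K) series_term w0 n j| <= d.
  by apply: le_trans (t0 _) hd => j j0; rewrite expn_gt0 j0.
have {}t1 : `|\sum_(J <= j < K) series_term id n j| <= d.
  by apply: le_trans (t1 _) hd => j j0; rewrite -mulnn leq_pmulr.
have {}t2 : `|\sum_(J <= j < K) series_term w2 n j| <= d.
  by apply: le_trans (t2 _) hd => j j0; rewrite /w2 -mulnn leq_mul2l leq_pred orbT.
have E0 : (disc_even n Q).[x] <= - (s0 - d).
  rewrite e0 (eq_bigr (fun j : 'I_K => (w0 j)%:R * ((disc_even n Q)`_j * x ^+ j))).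
    rewrite split_sum; move: t0; rewrite ler_norml => /andP[_ t0]; lra.
  by move=> j _; rewrite mul1r.
have E2 : x ^+ 2 * (disc_even n Q)^`()^`().[x] <= - (s2 - d).
  rewrite e2 (split_sum w2); move: t2; rewrite ler_norml => /andP[_ t2]; lra.
have E1 : `| x * (disc_even n Q)^`().[x] | <= s1 + d.
  by rewrite e1 (split_sum id); apply: le_trans (ler_normD _ _) _; rewrite lerD// ltW.
have := Laguerre_ineq x hyp; apply/negP; rewrite -ltNge subr_lt0.
have x20 : 0 < x ^+ 2 by rewrite exprn_even_gt0.
rewrite -(ltr_pM2l x20) -exprMn mulrCA.
have sq : (x * (disc_even n Q)^`().[x]) ^+ 2 <= (s1 + d) ^+ 2.
  rewrite -[leLHS]real_normK ?num_real// ler_sqr ?nnegrE//.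
  exact: le_trans (normr_ge0 _) E1.
apply: le_lt_trans sq _; apply: lt_le_trans hs _.
move: E0 E2; move: ((disc_even n Q).[x]) (x ^+ 2 * _) => A B.
rewrite lerNr => A0; rewrite lerNr => B0.
rewrite -[leRHS]mulrNN; apply: ler_pM => //; rewrite subr_ge0 ltW.
Unshelve. all: by end_near. Qed.

End numeric.

(** * Numerical certificates *)

Section certificate.
Context {R : realType}.
Local Notation Z := BinNums.Z.
Local Notation Zadd := BinInt.Z.add.
Local Notation Zmul := BinInt.Z.mul.
Local Notation Zopp := BinInt.Z.opp.
Local Notation Zltb := BinInt.Z.ltb.
Local Notation Znat := BinInt.Z.of_nat.

Definition real_of_Z (z : Z) : R := (int_of_Z z)%:~R.

Lemma real_of_ZD z1 z2 : real_of_Z (Zadd z1 z2) = real_of_Z z1 + real_of_Z z2.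
Proof. by rewrite /real_of_Z -rmorphD -rmorphD. Qed.

Lemma real_of_ZM z1 z2 : real_of_Z (Zmul z1 z2) = real_of_Z z1 * real_of_Z z2.
Proof. by rewrite /real_of_Z -rmorphM -rmorphM. Qed.

Lemma real_of_ZN z : real_of_Z (Zopp z) = - real_of_Z z.
Proof. by rewrite /real_of_Z -rmorphN -rmorphN. Qed.

Lemma real_of_Z_nat n : real_of_Z (Znat n) = n%:R.
Proof. by rewrite /real_of_Z (_ : int_of_Z _ = n%:Z) ?pmulrn//; lia. Qed.

Lemma real_of_Z_lt z1 z2 : Zltb z1 z2 -> real_of_Z z1 < real_of_Z z2.
Proof. by move=> h; rewrite ltr_int; lia. Qed.

(** Numerator and denominator of a partial sum, with the current power of -m, in
binary integers so that they can be evaluated. *)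
Fixpoint series_part_Z (w : nat -> nat) Q m J : Z * Z * Z :=
  match J with
  | 0%N => (Znat 0, Znat 1, Znat 1)
  | j.+1 =>
    let: (N, D, P) := series_part_Z w Q m j in
    let d := Znat (series_den Q j) in
    (Zmul (Zadd N (Zmul (Znat (w j)) P)) d, Zmul D d, Zmul P (Zopp (Znat m)))
  end.

Lemma series_part_ZS w Q m j : series_part_Z w Q m j.+1 =
  let: (N, D, P) := series_part_Z w Q m j in
  let d := Znat (series_den Q j) in
  (Zmul (Zadd N (Zmul (Znat (w j)) P)) d, Zmul D d, Zmul P (Zopp (Znat m))).
Proof. by []. Qed.

Lemma series_part_ZP w Q m J : let: (N, D, P) := series_part_Z w Q m J in
  [/\ 0 < real_of_Z D, real_of_Z P = (- m%:R) ^+ J,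
      (series_coef Q J) * real_of_Z D = 1 &
      series_part Q m w J * real_of_Z D = real_of_Z N].
Proof.
elim: J => [|J].
  rewrite /series_part_Z /series_part /series_coef !big_ord0 mul0r mul1r expr0.
  by rewrite !real_of_Z_nat; split; rewrite ?ltr01.
rewrite series_part_ZS; case: (series_part_Z w Q m J) => -[N D] P [D0 PE cE NE].
(* Only the matches on triples are reduced: the integer operations stay folded. *)
cbv beta iota zeta; rewrite !real_of_ZM real_of_ZN real_of_ZD real_of_ZM !real_of_Z_nat.
rewrite series_coefS /series_part big_ord_recr/= -/(series_part _ _ _ _).
have d0 := @series_den_gt0 R Q J; have d0' := lt0r_neq0 d0.
split; first exact: mulr_gt0.
- by rewrite PE exprSr.
- by rewrite mulrACA cE mul1r mulVf.
- rewrite -NE -PE mulrA mulrDl; congr (_ * _); congr (_ + _).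
  by rewrite mulrAC -(mulrA _ (series_coef Q J)) cE mulr1.
Qed.

Lemma series_part_lt w Q m J a b :
  (let: (N, D, P) := series_part_Z w Q m J in
   Zltb (Zmul N (Znat b.+1)) (Zmul (Znat a) D)) ->
  series_part Q m w J < a%:R / b.+1%:R :> R.
Proof.
have := series_part_ZP w Q m J.
case: (series_part_Z w Q m J) => -[N D] P [D0 _ _ NE] /real_of_Z_lt.
rewrite !real_of_ZM !real_of_Z_nat -NE ltr_pdivlMr ?ltr0n// mulrAC.
by rewrite ltr_pM2r.
Qed.

Lemma series_part_ltN w Q m J a b :
  (let: (N, D, P) := series_part_Z w Q m J in
   Zltb (Zmul N (Znat b.+1)) (Zmul (Zopp (Znat a)) D)) ->
  series_part Q m w J < - (a%:R / b.+1%:R) :> R.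
Proof.
have := series_part_ZP w Q m J.
case: (series_part_Z w Q m J) => -[N D] P [D0 _ _ NE] /real_of_Z_lt.
rewrite !real_of_ZM real_of_ZN !real_of_Z_nat -NE -mulNr ltr_pdivlMr ?ltr0n//.
by rewrite mulrAC ltr_pM2r.
Qed.

Lemma series_part_gtN w Q m J a b :
  (let: (N, D, P) := series_part_Z w Q m J in
   Zltb (Zmul (Zopp (Znat a)) D) (Zmul N (Znat b.+1))) ->
  - (a%:R / b.+1%:R) < series_part Q m w J :> R.
Proof.
have := series_part_ZP w Q m J.
case: (series_part_Z w Q m J) => -[N D] P [D0 _ _ NE] /real_of_Z_lt.
rewrite !real_of_ZM real_of_ZN !real_of_Z_nat -NE -mulNr ltr_pdivrMr ?ltr0n//.
by rewrite [_ * real_of_Z D * _]mulrAC ltr_pM2r.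
Qed.

Lemma majorant_lt w Q m J a b : ~~ odd J ->
  (let: (N, D, P) := series_part_Z w Q m J in
   Zltb (Zmul (Zmul (Znat (J ^ 2)) P) (Znat b.+1)) (Zmul (Znat a) D)) ->
  majorant Q m J < a%:R / b.+1%:R :> R.
Proof.
move=> oJ; have := series_part_ZP w Q m J.
case: (series_part_Z w Q m J) => -[N D] P [D0 PE cE _] /real_of_Z_lt.
rewrite !real_of_ZM !real_of_Z_nat PE exprNn -signr_odd (negbTE oJ) expr0 mul1r.
move=> h; rewrite ltr_pdivlMr ?ltr0n// -(ltr_pM2r D0).
have -> : majorant Q m J * b.+1%:R * real_of_Z D =
    (J ^ 2)%:R * m%:R ^+ J * b.+1%:R * (series_coef Q J * real_of_Z D) :> R.
  rewrite /majorant [RHS]mulrA; congr (_ * _).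
  by rewrite [RHS]mulrAC; congr (_ * _); rewrite mulrAC.
by rewrite cE mulr1.
Qed.

Lemma disc_even5_not_rooted : exists N, forall n, (0 < n)%N -> (N <= n)%N ->
  ~ nonpos_rooted (disc_even n 5 : {poly R}).
Proof.
(* At u = -260 the sums are close to -0.00183, 0.01183 and -1.1686. *)
apply: (@disc_even_not_rooted R 5 260 28 (18%:R / 10000%:R) (12%:R / 1000%:R)
  (11%:R / 10%:R) (2%:R / 10000%:R)) => //; last 3 first.
- by lra.
- by lra.
- by lra.
- have : majorant 5 260 28 < 1%:R / 10000%:R :> R.
    by apply: (@majorant_lt id); vm_compute.
  lra.
- by apply: series_part_ltN; vm_compute.
- rewrite ltr_norml; apply/andP; split.
    by apply: series_part_gtN; vm_compute.
  by apply: series_part_lt; vm_compute.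
- by apply: series_part_ltN; vm_compute.
Qed.

Lemma disc_even6_not_rooted : exists N, forall n, (0 < n)%N -> (N <= n)%N ->
  ~ nonpos_rooted (disc_even n 6 : {poly R}).
Proof.
(* At u = -100 the sums are close to -0.02216, 0.09545 and -1.3133. *)
apply: (@disc_even_not_rooted R 6 100 28 (22%:R / 1000%:R) (96%:R / 1000%:R)
  (13%:R / 10%:R) (2%:R / 10000%:R)) => //; last 3 first.
- by lra.
- by lra.
- by lra.
- have : majorant 6 100 28 < 1%:R / 10000%:R :> R.
    by apply: (@majorant_lt id); vm_compute.
  lra.
- by apply: series_part_ltN; vm_compute.
- rewrite ltr_norml; apply/andP; split.
    by apply: series_part_gtN; vm_compute.
  by apply: series_part_lt; vm_compute.
- by apply: series_part_ltN; vm_compute.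
Qed.

End certificate.

(** * From the ellipsoids to the limit polynomials *)

Section assembly.
Context {R : realType}.

(** The coefficients are fixed linear combinations of the values at 1, ..., K, by
inverting a Vandermonde matrix. *)
Lemma coef_cvg_of_values K (M_ : nat -> {poly R}) (P : {poly R}) :
  (forall k, size (M_ k) <= K)%N -> (size P <= K)%N ->
  (forall i : nat, ((M_ k).[i.+1%:R] @[k --> \oo] --> P.[i.+1%:R])%classic) ->
  forall j, ((M_ k)`_j @[k --> \oo] --> P`_j)%classic.
Proof.
move=> sM sP cv j.
have [Kj|jK] := leqP K j.
  rewrite nth_default ?(leq_trans sP)//.
  under eq_fun do rewrite nth_default ?(leq_trans (sM _))//.
  exact: cvg_cst.
pose V : 'M[R]_K := Vandermonde K (\row_(i < K) i.+1%:R).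
have uV : V \in unitmx.
  rewrite unitmxE unitfE det_Vandermonde; apply/prodf_neq0 => i _.
  by apply/prodf_neq0 => i' ii'; rewrite !mxE subr_eq0 eqr_nat eqSS gt_eqF.
have coefE (p : {poly R}) : (size p <= K)%N ->
    p`_j = \sum_(i < K) p.[i.+1%:R] * invmx V i (Ordinal jK).
  move=> sp; pose c : 'rV[R]_K := \row_i p`_i.
  have cV : c *m V = \row_i p.[i.+1%:R].
    apply/rowP => i; rewrite !mxE (horner_coef_wide _ sp).
    by apply: eq_bigr => l _; rewrite !mxE.
  have := congr1 (fun r : 'rV[R]_K => r ord0 (Ordinal jK)) (mulmxK uV c).
  rewrite cV !mxE => <-; apply: eq_bigr => i _.
  by rewrite !mxE.
rewrite (coefE _ sP); under eq_fun do rewrite (coefE _ (sM _)).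
apply: cvgn_sum => i; apply: cvgM; first exact: cv.
exact: cvg_cst.
Qed.

Lemma size_disc_poly n q : (size (disc_poly n q : {poly R}) <= (n + q).+1)%N.
Proof.
apply: (leq_trans (size_sum _ _ _)); apply/bigmax_leqP => k _.
apply: (leq_trans (size_scale_leq _ _)); rewrite size_polyXn ltnS addnC.
by rewrite leq_add2r -ltnS.
Qed.

Lemma minkowski_coef_cvg n q (eps : nat -> R) (M_ : nat -> {poly R}) :
  (forall k, 0 < eps k <= k.+1%:R^-1) ->
  (forall k, is_minkowski_poly (ellipsoid n q (eps k)) (M_ k)) ->
  forall j, ((M_ k)`_j @[k --> \oo] --> (disc_poly n q)`_j)%classic.
Proof.
move=> he hM; apply: (@coef_cvg_of_values (n + q).+1).
- by move=> k; have [] := hM k.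
- exact: size_disc_poly.
move=> i; have ce : (eps k @[k --> \oo] --> (0 : R))%classic.
  apply: (@squeeze_cvgr _ _ _ R (fun=> 0) (fun k => k.+1%:R^-1)).
  - by apply: nearW => k; have /andP[/ltW -> ->] := he k.
  - exact: cvg_cst.
  - exact: cvg_harmonic.
apply: (@squeeze_cvgr _ _ _ R (fun=> (disc_poly n q).[i.+1%:R])
  (fun k => (disc_poly n q).[i.+1%:R + eps k])).
- apply: nearW => k; have /andP[e0 _] := he k.
  exact: (minkowski_poly_bounds e0 (ltr0Sn _ _) (hM k)).
- exact: cvg_cst.
- have h : ((i.+1%:R + eps k : R) @[k --> \oo] --> (i.+1%:R : R))%classic.
    have := cvgD (@cvg_cst _ (i.+1%:R : R) nat \oo _) ce.
    by rewrite addr0; exact.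
  exact: (cvg_comp _ _ h (@continuous_horner _ (disc_poly n q) _)).
Qed.

(** If no eps0 works, the exceptions for eps0 = 1/(k+1) form a sequence of
Minkowski polynomials which converges to the one of the flat disc. *)
Lemma small_eps_of_limit n q (P : {poly R} -> Prop) :
  (forall M_ : nat -> {poly R}, (forall k, (size (M_ k) <= (n + q).+1)%N) ->
    (forall j, ((M_ k)`_j @[k --> \oo] --> (disc_poly n q)`_j)%classic) ->
    (forall k, ~ P (M_ k)) -> False) ->
  exists2 eps0 : R, 0 < eps0 & forall eps : R, 0 < eps -> eps <= eps0 ->
    forall M : {poly R}, is_minkowski_poly (ellipsoid n q eps) M -> P M.
Proof.
move=> hP; apply: contrapT => hn.
have h k : exists eM : R * {poly R}, [/\ 0 < eM.1 <= k.+1%:R^-1,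
    is_minkowski_poly (ellipsoid n q eM.1) eM.2 & ~ P eM.2].
  apply: contrapT => hk; apply: hn; exists k.+1%:R^-1; first by rewrite invr_gt0.
  move=> e e0 ek M hM; apply: contrapT => hPM; apply: hk.
  by exists (e, M); split => //=; rewrite e0.
have [f hf] := choice h.
apply: (hP (fun k => (f k).2)).
- by move=> k; have [_ [] ] := hf k.
- by apply: (minkowski_coef_cvg (eps := fun k => (f k).1)) => k; have [] := hf k.
- by move=> k; have [] := hf k.
Qed.

Lemma coef_disc_poly n q j : (disc_poly n q : {poly R})`_j =
  if (q <= j)%N then 'C(n, j - q)%:R * kappa n * (kappa j / kappa (j - q)) else 0.
Proof.
rewrite coef_sum; case: ifPn => [qj|]; last first.
  rewrite -ltnNge => jq; apply: big1 => k _.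
  by rewrite coefZ coefXn ltn_eqF ?mulr0// ltn_addr.
have [kn|kn] := leqP (j - q) n; last first.
  rewrite bin_small// !mul0r; apply: big1 => k _.
  by rewrite coefZ coefXn gtn_eqF ?mulr0//; have := ltn_ord k; lia.
rewrite (bigD1 (Ordinal (kn : (j - q < n.+1)%N)))//= coefZ coefXn subnKC// eqxx mulr1.
rewrite big1 ?addr0// => k; rewrite -val_eqE/= => kj.
by rewrite coefZ coefXn; case: eqP => [jE|]; rewrite ?mulr0//; lia.
Qed.

Lemma kappa_beta q i :
  kappa (q + 2 * i) / kappa (2 * i) = kappa q / kappa 0 * beta_ratio q i :> R.
Proof.
have k0 m : kappa m != 0 :> R by rewrite gt_eqF// kappa_gt0.
elim: i => [|i IH]; first by rewrite muln0 addn0 /beta_ratio big_ord0 mulr1.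
rewrite beta_ratioS mulrA -IH.
have -> : (q + 2 * i.+1 = (q + 2 * i).+2)%N by lia.
have -> : (2 * i.+1 = (2 * i).+2)%N by lia.
have e1 := @kappaS2 R (q + 2 * i); have e2 := @kappaS2 R (2 * i).
have pi0 : pi != 0 :> R by rewrite gt_eqF// pi_gt0.
have n1 : (q + 2 * i)%:R / 2 + 1 != 0 :> R by rewrite gt_eqF// ltr_wpDl// divr_ge0.
have n2 : (2 * i)%:R / 2 + 1 != 0 :> R by rewrite gt_eqF// ltr_wpDl// divr_ge0.
have -> : kappa (q + 2 * i).+2 = pi * kappa (q + 2 * i) / ((q + 2 * i)%:R / 2 + 1) :> R.
  by rewrite -e1 mulfK.
have -> : kappa (2 * i).+2 = pi * kappa (2 * i) / ((2 * i)%:R / 2 + 1) :> R.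
  by rewrite -e2 mulfK.
have -> : ((2 * i).+2 + q)%:R = 2 * ((q + 2 * i)%:R / 2 + 1) :> R.
  by rewrite -[(2 * i).+2]addn2 !natrD; field.
have -> : (2 * i).+2%:R = 2 * ((2 * i)%:R / 2 + 1) :> R.
  by rewrite -[(2 * i).+2]addn2 !natrD; field.
clear e1 e2; move: n1 n2 (k0 (2 * i)%N) (k0 (q + 2 * i)%N).
move: ((q + 2 * i)%:R / 2 + 1) ((2 * i)%:R / 2 + 1) (kappa (2 * i)) (kappa (q + 2 * i)).
move: (pi : R) pi0 => u u0 a b x y a0 b0 x0 y0.
by field; rewrite a0 b0 x0 u0.
Qed.

(** Real-rootedness survives the limit, and also division by the constant and the
power of the variable. *)
Lemma disc_even_rooted_of_limit (c : R) s n Q (w_ : nat -> {poly R}) (w : {poly R}) K :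
  0 < c -> (forall j, w`_j = if (s <= j)%N then c * (disc_even n Q)`_(j - s) else 0) ->
  (forall k, (size (w_ k) <= K)%N) -> (size w <= K)%N ->
  (forall j, ((w_ k)`_j @[k --> \oo] --> w`_j)%classic) ->
  (forall k, nonpos_rooted (w_ k)) -> nonpos_rooted (disc_even n Q : {poly R}).
Proof.
move=> c0 wE sw_ sw cv hw.
have wX : w = c *: ('X^s * disc_even n Q).
  apply/polyP => j; rewrite wE coefZ coefXnM ltnNge.
  by case: (s <= j)%N => //=; rewrite mulr0.
have w0 : w != 0.
  by rewrite wX scaler_eq0 negb_or gt_eqF//= mulf_neq0 ?disc_even_neq0// expf_neq0 ?polyX_eq0.
have mw : vertical_mono w.
  by apply: (vertical_mono_lim sw_ sw cv) => k; exact: nonpos_rooted_mono.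
have rw : nonpos_rooted w.
  apply: vertical_mono_nonpos => // j; rewrite wE; case: ifP => // _.
  by rewrite mulr_ge0 ?(ltW c0)// coef_disc_even mulr_ge0// ltW// beta_ratio_gt0.
apply: nonpos_rootedP => z rz; apply: (nonpos_rooted_root rw w0).
rewrite wX /complex_poly map_polyZ/= rmorphM/= rootZ ?fmorph_eq0 ?gt_eqF//.
by rewrite rootM rz orbT.
Qed.

Lemma disc_even_rooted_of_stable n q (M_ : nat -> {poly R}) :
  (forall k, (size (M_ k) <= (n + q).+1)%N) ->
  (forall j, ((M_ k)`_j @[k --> \oo] --> (disc_poly n q)`_j)%classic) ->
  (forall k z, root (complex_poly (M_ k)) z -> complex.Re z <= 0) ->
  nonpos_rooted (disc_even n q : {poly R}).
Proof.
move=> sM cM hM.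
(* The lowest exponent q of the limit decides which parity is kept. *)
pose part (p : {poly R}) := if odd q then odd_poly p else even_poly p.
have partE p j : (part p)`_j = p`_(odd q + 2 * j).
  rewrite /part; case: (odd q); rewrite ?coef_odd_poly ?coef_even_poly;
  by congr (_`_ _); lia.
have size_part (p : {poly R}) : (size p <= (n + q).+1)%N -> (size (part p) <= (n + q).+1)%N.
  move=> sp; apply/leq_sizeP => j hj; rewrite partE nth_default//.
  by apply: leq_trans sp _; lia.
apply: (@disc_even_rooted_of_limit (kappa n * (kappa q / kappa 0)) q./2 n q
  (fun k => part (M_ k)) (part (disc_poly n q)) (n + q).+1).
- by rewrite mulr_gt0 ?divr_gt0 ?kappa_gt0.
- move=> j; rewrite partE coef_disc_poly.
  have qE := odd_double_half q.
  have -> : (q <= odd q + 2 * j)%N = (q./2 <= j)%N by lia.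
  case: ifP => // hj; rewrite coef_disc_even.
  have -> : (odd q + 2 * j - q = 2 * (j - q./2))%N by lia.
  have -> : (odd q + 2 * j = q + 2 * (j - q./2))%N by lia.
  by rewrite kappa_beta; ring.
- by move=> k; exact: size_part.
- exact/size_part/size_disc_poly.
- by move=> j; rewrite partE; under eq_fun do rewrite partE; exact: cM.
- move=> k; rewrite /part; case: (odd q).
    exact: stable_odd_part (hM k).
  exact: stable_even_part (hM k).
Qed.

Definition weyl_factor p l : R :=
  2 ^- l * Gamma (p%:R / 2 + 1) / Gamma (p%:R / 2 + l%:R + 1)
  * (2 ^+ l * (Gamma (l%:R + 2^-1 + 1) / Gamma (2^-1 + 1))).

(** The Weyl polynomial as a polynomial in t^2. *)
Definition weyl_half N p (M : {poly R}) : {poly R} :=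
  \poly_(l < (N.-1)./2.+1) (weyl_factor p l * M`_(2 * l).+1).

Lemma weyl_halfE N p (M : {poly R}) : weyl_poly N p M = weyl_half N p M \Po 'X^2.
Proof.
rewrite /weyl_half poly_def raddf_sum/=; apply: eq_bigr => l _.
rewrite comp_polyZ comp_Xn_poly -exprM /weyl_coef /weyl_factor; congr (_ *: _).
by rewrite !mulrA.
Qed.

Lemma weyl_factorE p l : weyl_factor p l =
  Gamma (p%:R / 2 + 1) / Gamma (1%:R / 2 + 1) *
  (Gamma ((2 * l).+1%:R / 2 + 1) / Gamma ((p + 2 * l)%:R / 2 + 1)).
Proof.
rewrite /weyl_factor mul1r.
have -> : (2 * l).+1%:R / 2 = l%:R + 2^-1 :> R by rewrite -natr1 natrM; field.
have -> : (p + 2 * l)%:R / 2 = p%:R / 2 + l%:R :> R by rewrite natrD natrM; field.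
have t0 : 2 ^+ l != 0 :> R by rewrite expf_neq0// pnatr_eq0.
move: (Gamma _) (Gamma _)^-1 (Gamma _) (Gamma _)^-1 => a b c d.
by rewrite mulrACA mulrCA !mulrA; field.
Qed.

Lemma weyl_factor_gt0 p l : 0 < weyl_factor p l.
Proof. by rewrite weyl_factorE mulr_gt0// divr_gt0 ?Gamma_half_gt0. Qed.

Lemma weyl_factorS p l : weyl_factor p l.+1 =
  weyl_factor p l * ((2 * l).+3%:R / (p + (2 * l).+2)%:R).
Proof.
rewrite !weyl_factorE -[RHS]mulrA; congr (_ * _).
have -> : (2 * l.+1 = (2 * l).+2)%N by lia.
rewrite addnS addnS !Gamma_halfS2.
have G0 := lt0r_neq0 (@Gamma_half_gt0 R (p + 2 * l)).
have -> : (2 * l).+3%:R = 2 * ((2 * l).+1%:R / 2 + 1) :> R.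
  by rewrite -[(2 * l).+3]addn2 natrD; field.
have -> : (p + 2 * l).+2%:R = 2 * ((p + 2 * l)%:R / 2 + 1) :> R.
  by rewrite -[(p + 2 * l).+2]addn2 natrD; field.
have n1 : (p + 2 * l)%:R / 2 + 1 != 0 :> R by rewrite gt_eqF// ltr_wpDl// divr_ge0.
move: n1 G0; move: ((p + 2 * l)%:R / 2 + 1) => x; move: (Gamma x) => g x0 g0.
move: ((2 * l).+1%:R / 2 + 1) => y.
by field; rewrite x0 g0.
Qed.

(** The Gamma factors of the Weyl polynomial replace the codimension q = 2s+1 by
p + q - 1 = p + 2s. *)
Lemma weyl_kappa p s i : let q := (2 * s).+1 in
  weyl_factor p (s + i) * (kappa (q + 2 * i) / kappa (2 * i)) =
  weyl_factor p s * (kappa q / kappa 0) * beta_ratio (p + 2 * s) i.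
Proof.
move=> q; rewrite kappa_beta.
suff E : weyl_factor p (s + i) * beta_ratio q i =
    weyl_factor p s * beta_ratio (p + 2 * s) i :> R.
  by rewrite mulrCA E mulrCA mulrA.
elim: i => [|i IH]; first by rewrite addn0 /beta_ratio !big_ord0.
rewrite addnS weyl_factorS !beta_ratioS mulrACA IH -mulrA; congr (_ * _).
have -> : ((2 * (s + i)).+3 = 2 * i.+1 + q)%N by rewrite /q; lia.
have -> : (p + (2 * (s + i)).+2 = 2 * i.+1 + (p + 2 * s))%N by lia.
congr (_ * _).
have n0 : (2 * i.+1 + q)%:R != 0 :> R by rewrite pnatr_eq0.
by rewrite mulrC mulrA divfK.
Qed.

Lemma disc_even_rooted_of_weyl n p q (M_ : nat -> {poly R}) : odd q ->
  (forall k, (size (M_ k) <= (n + q).+1)%N) ->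
  (forall j, ((M_ k)`_j @[k --> \oo] --> (disc_poly n q)`_j)%classic) ->
  (forall k z, root (complex_poly (weyl_poly (n + q) p (M_ k))) z -> complex.Re z = 0) ->
  nonpos_rooted (disc_even n (p + q).-1 : {poly R}).
Proof.
move=> oq sM cM hM.
have qE : q = (2 * q./2).+1 by rewrite -[LHS]odd_double_half oq; lia.
have halfE (M : {poly R}) l : (size M <= (n + q).+1)%N ->
    (weyl_half (n + q) p M)`_l = weyl_factor p l * M`_(2 * l).+1.
  move=> sz; rewrite coef_poly; case: ifPn => //; rewrite -leqNgt => hl.
  by rewrite nth_default ?mulr0//; apply: leq_trans sz _; lia.
have size_half (M : {poly R}) : (size (weyl_half (n + q) p M) <= (n + q).+1)%N.
  by apply: leq_trans (size_poly _ _) _; lia.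
apply: (@disc_even_rooted_of_limit
  (kappa n * (weyl_factor p q./2 * (kappa q / kappa 0))) q./2 n (p + q).-1
  (fun k => weyl_half (n + q) p (M_ k)) (weyl_half (n + q) p (disc_poly n q)) (n + q).+1).
- by rewrite mulr_gt0 ?kappa_gt0// mulr_gt0 ?weyl_factor_gt0// divr_gt0 ?kappa_gt0.
- move=> l; rewrite halfE ?size_disc_poly// coef_disc_poly.
  have -> : (q <= (2 * l).+1)%N = (q./2 <= l)%N by lia.
  case: ifPn => hl; last by rewrite mulr0.
  rewrite coef_disc_even.
  have -> : ((2 * l).+1 - q = 2 * (l - q./2))%N by lia.
  have -> : ((2 * l).+1 = q + 2 * (l - q./2))%N by lia.
  rewrite -{1}(subnKC hl).
  have := @weyl_kappa p q./2 (l - q./2); rewrite /= -qE => E.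
  have -> : ((p + q).-1 = p + 2 * q./2)%N by rewrite {1}qE addnS.
  have -> (x y z w : R) : x * (y * z * w) = y * z * (x * w) by ring.
  by rewrite E; ring.
- by move=> k; exact: size_half.
- exact: size_half.
- move=> l; rewrite halfE ?size_disc_poly//.
  under eq_fun do rewrite halfE//.
  by apply: cvgM; [exact: cvg_cst|exact: cM].
- move=> k; apply: even_imag_rooted => t; rewrite -weyl_halfE; exact: hM.
Qed.

End assembly.

Theorem theorem2p7 (R : realType) :
  (forall q : nat, (5 <= q)%N ->
     exists N0 : nat, forall n : nat, (1 <= n)%N -> (N0 <= n)%N ->
       exists2 eps0 : R, 0 < eps0 &
         forall eps : R, 0 < eps -> eps <= eps0 ->
           forall M : {poly R}, is_minkowski_poly (ellipsoid n q eps) M ->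
             ~ dissipative (complex_poly M) /\
             exists z : R[i], root (complex_poly M) z /\ 0 < complex.Re z)
  /\
  (forall p q : nat, (1 <= p)%N -> (1 <= q)%N -> odd q -> (6 <= p + q)%N ->
     exists N0 : nat, forall n : nat, (1 <= n)%N -> (N0 <= n)%N ->
       exists2 eps0 : R, 0 < eps0 &
         forall eps : R, 0 < eps -> eps <= eps0 ->
           forall M : {poly R}, is_minkowski_poly (ellipsoid n q eps) M ->
             ~ conservative (complex_poly (weyl_poly (n + q) p M)) /\
             exists z : R[i],
               root (complex_poly (weyl_poly (n + q) p M)) z /\
               complex.Re z <> 0).
Proof.
have [N5 h5] := @disc_even5_not_rooted R; have [N6 h6] := @disc_even6_not_rooted R.
have not_rooted n Q : (5 <= Q)%N -> (1 <= n)%N -> (maxn N5 N6 <= n)%N ->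
    ~ nonpos_rooted (disc_even n Q : {poly R}).
  rewrite geq_max => Q5 n1 /andP[n5 n6] /(disc_even_base Q5)[|].
    exact: h5.
  exact: h6.
split=> [q q5|p q p1 q1 oq pq]; exists (maxn N5 N6) => n n1 Nn.
- apply: (small_eps_of_limit (P := fun M => ~ dissipative (complex_poly M) /\
    exists z : R[i], root (complex_poly M) z /\ 0 < complex.Re z)) => M_ sM cM hM.
  apply: (not_rooted n q q5 n1 Nn).
  apply: (disc_even_rooted_of_stable sM cM) => k z rz.
  rewrite leNgt; apply/negP => z0; apply: (hM k); split; last by exists z.
  by move=> /(_ z rz); rewrite ltNge (ltW z0).
- apply: (small_eps_of_limit (P := fun M =>
    ~ conservative (complex_poly (weyl_poly (n + q) p M)) /\
    exists z : R[i], root (complex_poly (weyl_poly (n + q) p M)) z /\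
      complex.Re z <> 0)) => M_ sM cM hM.
  apply: (not_rooted n (p + q).-1 _ n1 Nn); first by lia.
  apply: (disc_even_rooted_of_weyl oq sM cM (p := p)) => k z rz.
  apply: contrapT => z0; apply: (hM k); split; last by exists z.
  by move=> /(_ z rz)[].
Qed.
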